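(* There exist a probability measure $\sigma$ on $\mathbb{T}$ with infinite support belonging to the Szeg\H{o} class and a sequence $\{\alpha_n\}_{n\in\mathbb{Z}^+}\in\ell^2(\mathbb{Z}^+)$ such that the series $\sum_{n\in\mathbb{Z}^+}\alpha_n\phi_n(z,\sigma)$ diverges at every $z\in\mathbb{T}$.
   Context: $\mathbb{T}$ is the unit circle, $\mathbb{Z}^+=\{0,1,2,\dots\}$, and $m$ the normalized Lebesgue (probability) measure on $\mathbb{T}$. For a probability measure $\sigma$ on $\mathbb{T}$ with infinite support, $\phi_n(z,\sigma)$ denotes the orthonormal polynomials: $\deg\phi_n=n$, positive leading coefficient, $\int_{\mathbb{T}}\phi_n\overline{\phi_k}\,d\sigma=\delta_{nk}$. The measure $\sigma$ is in the Szeg\H{o} class if, writing $d\sigma=w\,dm+d\sigma_s$ with $\sigma_s$ singular, $\int_{\mathbb{T}}\log w\,dm>-\infty$. *)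

(* Defs.v *)
From HB Require Import structures.
From mathcomp Require Import all_boot all_order all_algebra.
From mathcomp Require Import all_classical all_reals all_analysis.
From mathcomp Require Import complex.
Set Implicit Arguments. Unset Strict Implicit. Unset Printing Implicit Defensive.
Import Order.TTheory GRing.Theory Num.Theory.
Import numFieldNormedType.Exports.
Local Open Scope classical_set_scope.
Local Open Scope ring_scope.

(* Conventions: the unit circle T is parametrized by t in [0,1) via
   t |-> exp(2 pi i t); a (Borel) probability measure on T is a measure on R
   carried by [0,1); normalized Lebesgue measure m on T is Lebesgue measure
   restricted to [0,1). Complex numbers are R[i] (mathcomp-real-closed). *)

Definition zT (R : realType) (t : R) : R[i] :=
  Complex (cos (2 * pi * t)) (sin (2 * pi * t)).

Definition circle_prob (R : realType)
    (sigma : {measure set (measurableTypeR R) -> \bar R}) : Prop :=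
  sigma `[0%R, 1%R[%classic = 1%E /\ sigma (~` `[0%R, 1%R[%classic) = 0%E.

Definition supp (R : realType)
    (sigma : {measure set (measurableTypeR R) -> \bar R}) : set R :=
  [set t | forall e : R, 0 < e -> (0 < sigma (ball t e))%E].

Definition infinite_support (R : realType)
    (sigma : {measure set (measurableTypeR R) -> \bar R}) : Prop :=
  ~ finite_set (supp sigma).

Definition elog (R : realType) (x : R) : \bar R :=
  if x == 0 then -oo%E else (ln x)%:E.

Definition szego_class (R : realType)
    (sigma : {measure set (measurableTypeR R) -> \bar R}) : Prop :=
  exists (w : R -> R) (sigma_s : {measure set (measurableTypeR R) -> \bar R})
         (N : set R),
    [/\ (forall t, 0 <= w t), measurable_fun setT w,
        measurable N /\ (@lebesgue_measure R) N = 0%E /\ sigma_s (~` N) = 0%E,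
        (forall A, measurable A ->
           sigma A = (\int[@lebesgue_measure R]_(x in A `&` `[0%R, 1%R[%classic)
                        (w x)%:E + sigma_s A)%E) &
        (-oo < \int[@lebesgue_measure R]_(x in `[0%R, 1%R[%classic) elog (w x))%E].

Definition inner_eq (R : realType)
    (sigma : {measure set (measurableTypeR R) -> \bar R}) (p q : {poly R[i]})
    (c : R[i]) : Prop :=
  (\int[sigma]_(t in `[0%R, 1%R[%classic) (complex.Re (p.[zT t] * (conjc q.[zT t])))%:E
     = (complex.Re c)%:E)%E /\
  (\int[sigma]_(t in `[0%R, 1%R[%classic) (complex.Im (p.[zT t] * (conjc q.[zT t])))%:E
     = (complex.Im c)%:E)%E.

Definition orthonormal_polys (R : realType)
    (sigma : {measure set (measurableTypeR R) -> \bar R})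
    (phi : nat -> {poly R[i]}) : Prop :=
  (forall n, size (phi n) = n.+1) /\
  (forall n, 0 < lead_coef (phi n)) /\
  (forall n k, inner_eq sigma (phi n) (phi k) (if n == k then 1 else 0)).

Definition sqmod (R : realType) (a : R[i]) : R :=
  complex.Re a ^+ 2 + complex.Im a ^+ 2.

Definition ell2 (R : realType) (a : nat -> R[i]) : Prop :=
  cvgn (series (fun n => sqmod (a n))).

Definition cvgC (R : realType) (u : nat -> R[i]) : Prop :=
  cvgn (fun n => complex.Re (u n)) /\ cvgn (fun n => complex.Im (u n)).

(* Main.v *)
Require Import Defs.
From HB Require Import structures.
From mathcomp Require Import all_boot all_order all_algebra.
From mathcomp Require Import all_classical all_reals all_analysis.
From mathcomp Require Import measurable_realfun complex.
From mathcomp Require Import ring lra zify.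
Set Implicit Arguments. Unset Strict Implicit. Unset Printing Implicit Defensive.
Import Order.TTheory GRing.Theory Num.Theory.
Import numFieldNormedType.Exports.
Local Open Scope classical_set_scope.
Local Open Scope ring_scope.
Import Normc.
Local Notation "x %:C" := (real_complex _ x).

(** The measure is [w dm] with [w] bounded and bounded below, built from its
    Verblunsky coefficients [a_n] through the Szego recursion for the monic
    polynomials [Phi_n] and their reversals [Phi_n^*]; [k_n] is the square of
    the leading coefficient of [phi_n].

    The indices are cut into blocks, each with a centre [x] on the circle. On
    the middle third of a block [a_n] is [- mu k_n conj x conj (Phi_n x)], so
    that [Phi_n^*(z)] grows by multiples of the Christoffel-Darboux summands
    [conj (phi_n x) phi_n z]: the increment telescopes to [O(mu / |z - x|)].
    The coefficients of the series are [alpha_n = lam conj (phi_n x)], with a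
    trapezoidal cut-off; by the same formula a block contributes
    [lam delta / (1 - conj x z)] up to small errors, [delta > 0] being the
    increment of [Phi_n^*(x)]. Running through J equally spaced centres in
    cyclic order, the contributions of the centres on one side of [z] add up
    to [lam delta J log J], while the increments of [Phi_n^*] stay summable
    uniformly in [z]. Superblocks with J growing fast give, at every [z],
    infinitely many stretches of the series of modulus at least 1, although
    [alpha] is in l^2.

    Since [|Phi_n^* - 1| <= 1/16] on the circle, [1 / Phi_n^*] is a uniform limit
    of polynomials; this yields the Bernstein-Szego orthogonality relations for
    [1 / |phi_m|^2 dm], and [w] is the limit of these weights. *)

(** * The modulus of complex numbers *)

Section Modulus.
Variable R : realType.
Implicit Types (x y : R[i]) (r s : R).

Lemma normc_ge0 x : 0 <= normc x.
Proof. by case: x => a b /=; exact: sqrtr_ge0. Qed.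

Lemma normc_conj x : normc (conjc x) = normc x.
Proof. by case: x => a b /=; rewrite sqrrN. Qed.

Lemma normc_real r : normc r%:C = `|r|.
Proof. by rewrite /normc /= expr0n /= addr0 sqrtr_sqr. Qed.

Lemma real_complexM r s : (r * s)%:C = r%:C * s%:C.
Proof.
by apply/eqP; rewrite eq_complex /= !(mulr0, mul0r, addr0, subr0) !eqxx.
Qed.

Lemma sqr_normcE x : normc x ^+ 2 = complex.Re x ^+ 2 + complex.Im x ^+ 2.
Proof. by case: x => a b /=; rewrite sqr_sqrtr // addr_ge0 // sqr_ge0. Qed.

Lemma sqr_normc_mulJ x : (normc x ^+ 2)%:C = conjc x * x.
Proof.
rewrite sqr_normcE; case: x => a b.
apply/eqP; rewrite eq_complex /=; apply/andP; split; apply/eqP; ring.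
Qed.

Lemma normc_ge_absRe x : `|complex.Re x| <= normc x.
Proof.
rewrite -(ler_pXn2r (n := 2)) ?nnegrE ?normc_ge0 //.
by rewrite sqr_normcE real_normK ?num_real // lerDl sqr_ge0.
Qed.

Lemma normc_ge_absIm x : `|complex.Im x| <= normc x.
Proof.
rewrite -(ler_pXn2r (n := 2)) ?nnegrE ?normc_ge0 //.
by rewrite sqr_normcE real_normK ?num_real // lerDr sqr_ge0.
Qed.

Lemma normc_le_ReIm x : normc x <= `|complex.Re x| + `|complex.Im x|.
Proof.
rewrite -(ler_pXn2r (n := 2)) ?nnegrE ?normc_ge0 ?addr_ge0 //.
rewrite sqr_normcE sqrrD !real_normK ?num_real //.
by rewrite addrAC lerDl mulrn_wge0 // mulr_ge0.
Qed.

Lemma normc_eq0 x : (normc x == 0) = (x == 0).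
Proof. by apply/eqP/eqP => [/eq0_normc //|->]; rewrite normc0. Qed.

Lemma normc_gt0 x : (0 < normc x) = (x != 0).
Proof. by rewrite lt_def normc_ge0 andbT normc_eq0. Qed.

Lemma normcB x y : normc (x - y) = normc (y - x).
Proof. by rewrite -normcN opprB. Qed.

Lemma le_normcB x y : normc (x - y) <= normc x + normc y.
Proof. by rewrite -(normcN y) le_normcD. Qed.

Lemma normcX x n : normc (x ^+ n) = normc x ^+ n.
Proof.
by elim: n => [|n IH]; rewrite ?expr0 ?normc1 // !exprS normcM IH.
Qed.

Lemma le_normc_sum (I : Type) (s : seq I) (P : pred I) (F : I -> R[i]) :
  normc (\sum_(i <- s | P i) F i) <= \sum_(i <- s | P i) normc (F i).
Proof.
elim/big_rec2: _ => [|i y x _ IH]; first by rewrite normc0.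
by rewrite (le_trans (le_normcD _ _)) // lerD2l.
Qed.

Lemma Re_add x y : complex.Re (x + y) = complex.Re x + complex.Re y.
Proof. by case: x; case: y. Qed.

Lemma Im_add x y : complex.Im (x + y) = complex.Im x + complex.Im y.
Proof. by case: x; case: y. Qed.

Lemma Re_mul x y : complex.Re (x * y) =
  complex.Re x * complex.Re y - complex.Im x * complex.Im y.
Proof. by case: x; case: y. Qed.

Lemma Im_mul x y : complex.Im (x * y) =
  complex.Re x * complex.Im y + complex.Im x * complex.Re y.
Proof. by case: x => a b; case: y => c d /=. Qed.

Lemma Im_sum (I : Type) (s : seq I) (P : pred I) (F : I -> R[i]) :
  complex.Im (\sum_(i <- s | P i) F i) = \sum_(i <- s | P i) complex.Im (F i).
Proof. by elim/big_rec2: _ => [//|i y x _ <-]; rewrite Im_add. Qed.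

Lemma Im_realM r x : complex.Im (r%:C * x) = r * complex.Im x.
Proof. by rewrite Im_mul /= mul0r addr0. Qed.

Lemma normc1_conjV x : normc x = 1 -> x * conjc x = 1.
Proof. by move=> h; rewrite mulrC -sqr_normc_mulJ h expr1n. Qed.

End Modulus.

(** * The Szego recursion and the Christoffel-Darboux formula *)

Section Szego.
Variables (R : realType) (X : nat -> R[i]) (mu : nat -> R).
Implicit Types (x z : R[i]).

(** A function of the state alone: each coefficient is computed from the polynomials it is about to
    extend, so it can sit inside the recursion. *)
Definition verblunsky_at n (s : R * {poly R[i]} * {poly R[i]}) : R[i] :=
  - (mu n * s.1.1)%:C * conjc (X n) * conjc s.1.2.[X n].

(* State (kappa_n^2, Phi_n, Phi_n^* ) of the Szego recursion. *)
Fixpoint szego n : R * {poly R[i]} * {poly R[i]} :=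
  if n is m.+1 then
    let s := szego m in let a := verblunsky_at m s in
    (s.1.1 / (1 - normc a ^+ 2), 'X * s.1.2 - conjc a *: s.2,
     s.2 - a *: ('X * s.1.2))
  else (1, 1, 1).

Definition ksq n := (szego n).1.1.
Definition Phi n := (szego n).1.2.
Definition Phis n := (szego n).2.
Definition verb n : R[i] := verblunsky_at n (szego n).

Lemma ksq0 : ksq 0 = 1. Proof. by []. Qed.
Lemma ksqS n : ksq n.+1 = ksq n / (1 - normc (verb n) ^+ 2).
Proof. by []. Qed.
Lemma verbE n : verb n = - (mu n * ksq n)%:C * conjc (X n) * conjc (Phi n).[X n].
Proof. by []. Qed.
Lemma hPhiS n z :
  (Phi n.+1).[z] = z * (Phi n).[z] - conjc (verb n) * (Phis n).[z].
Proof. by rewrite [Phi _.+1]/= !hornerE. Qed.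
Lemma hPhisS n z :
  (Phis n.+1).[z] = (Phis n).[z] - verb n * (z * (Phi n).[z]).
Proof. by rewrite [Phis _.+1]/= !hornerE. Qed.
Lemma hPhis0 z : (Phis 0).[z] = 1.
Proof. by rewrite hornerC. Qed.

(** This normalisation supplies the value of the mean of [1 / Phis n] over the circle in
    [bernstein_szego]. *)
Lemma Phis_at0 n : (Phis n).[0] = 1.
Proof.
elim: n => [|n IH]; first exact: hPhis0.
by rewrite hPhisS IH mul0r mulr0 subr0.
Qed.

Lemma size_Phi_Phis n : [/\ size (Phi n) = n.+1, Phi n \is monic &
  (size (Phis n) <= n.+1)%N].
Proof.
elim: n => [|n [sP mP sQ]]; first by rewrite /Phi /Phis /= size_poly1 monic1.
have nz : Phi n != 0 by rewrite -size_poly_eq0 sP.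
have sXP : size ('X * Phi n) = n.+2 by rewrite mulrC size_mulX // sP.
have sl : (size (- (conjc (verb n) *: Phis n)) < size ('X * Phi n)%R)%N.
  by rewrite size_polyN sXP ltnS (leq_trans (size_scale_leq _ _)).
split.
- by rewrite [Phi _]/= size_polyDl.
- rewrite [Phi _]/= monicE lead_coefDl // -monicE.
  by rewrite monicMl ?monicX.
- rewrite [Phis _]/= (leq_trans (size_polyD _ _)) // geq_max.
  rewrite (leq_trans sQ) // size_polyN (leq_trans (size_scale_leq _ _)) //.
  by rewrite sXP.
Qed.

(** The recursion produces [Phis] without mentioning reversal; as [conj z = 1 / z] on the circle,
    running both recursions in parallel shows that it is the reversed polynomial there. *)
Lemma Phi_Phis n z : normc z = 1 ->
  (Phi n).[z] = z ^+ n * conjc (Phis n).[z].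
Proof.
move=> hz; have zz := normc1_conjV hz.
elim: n => [|n IH]; first by rewrite !hornerC conjc1 mulr1.
have e : z ^+ n * conjc z ^+ n = 1 by rewrite -exprMn zz expr1n.
rewrite hPhiS hPhisS IH; move: (verb n) (Phis n).[z] => v q.
rewrite !(rmorphB, rmorphM, rmorphXn) /= conjcK exprS mulrBr.
congr (_ - _); first by rewrite mulrA.
transitivity (conjc v * q * (z * conjc z) * (z ^+ n * conjc z ^+ n)); last ring.
by rewrite zz e !mulr1.
Qed.

Lemma normc_Phi n z : normc z = 1 -> normc (Phi n).[z] = normc (Phis n).[z].
Proof.
by move=> hz; rewrite Phi_Phis // normcM normcX hz expr1n mul1r normc_conj.
Qed.

(** The Christoffel-Darboux numerator: it vanishes at [n = 0] and, as long as the coefficients stay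
    in the open disc, equals [1 - conj x * z] times the sum of the kernels below [n]. *)
Definition cd n x z : R[i] := (ksq n)%:C *
  (conjc (Phis n).[x] * (Phis n).[z] - conjc (Phi n).[x] * (Phi n).[z]).

(** This is [conj (phi_n x) * phi_n z], written with monic polynomials so that no square root
    occurs. *)
Definition kern n x z : R[i] := (ksq n)%:C * (conjc (Phi n).[x] * (Phi n).[z]).

(* Christoffel-Darboux formula, in the form of its increments. *)
Lemma cdS n x z : normc (verb n) < 1 ->
  cd n.+1 x z = cd n x z + (1 - conjc x * z) * kern n x z.
Proof.
move=> hv; have nz : 1 - normc (verb n) ^+ 2 != 0.
  by rewrite subr_eq0 gt_eqF // expr_lt1 // ?normc_ge0.
(* The mixed terms of the two recursions cancel; the factor [1 - |v|^2] left over is the one that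
   [ksqS] divides by. *)
have e : conjc (Phis n.+1).[x] * (Phis n.+1).[z]
      - conjc (Phi n.+1).[x] * (Phi n.+1).[z] =
   (1 - normc (verb n) ^+ 2)%:C * (conjc (Phis n).[x] * (Phis n).[z]
     - conjc x * z * (conjc (Phi n).[x] * (Phi n).[z])).
  have -> : (1 - normc (verb n) ^+ 2)%:C = 1 - conjc (verb n) * verb n.
    rewrite -sqr_normc_mulJ; apply/eqP.
    by rewrite eq_complex /= subr0 !eqxx.
  rewrite !hPhiS !hPhisS; move: (verb n) => v.
  rewrite !(rmorphB, rmorphM) /= conjcK; ring.
have ek : (ksq n / (1 - normc (verb n) ^+ 2))%:C
    * (1 - normc (verb n) ^+ 2)%:C = (ksq n)%:C.
  by rewrite -real_complexM divfK.
rewrite /cd /kern e ksqS [LHS]mulrA ek; ring.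
Qed.

(** The coefficients are chosen for this identity: at [z = X n] on the circle the increment is the
    real number [mu n * ksq n * |Phi n (X n)|^2]. *)
Lemma PhisS_kern n z : (Phis n.+1).[z] =
  (Phis n).[z] + (mu n)%:C * (conjc (X n) * z * kern n (X n) z).
Proof. by rewrite hPhisS verbE real_complexM /kern; ring. Qed.

Lemma normc_verb n : normc (X n) = 1 -> 0 <= mu n -> 0 <= ksq n ->
  normc (verb n) = mu n * ksq n * normc (Phi n).[X n].
Proof.
move=> hX hm hk; rewrite verbE !normcM normcN normc_real !normc_conj hX mulr1.
by rewrite ger0_norm // mulr_ge0.
Qed.

End Szego.

(** * Indices cut into consecutive blocks of given lengths *)

Section Concatenation.
Variable len : nat -> nat.

Definition start s := (\sum_(i < s) len i)%N.

(** Block number and offset of an index, found by walking through the indices one at a time; with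
    positive lengths this inverts [start]. *)
Fixpoint locate n : nat * nat :=
  if n is m.+1 then
    let p := locate m in if (p.2.+1 < len p.1)%N then (p.1, p.2.+1) else (p.1.+1, 0%N)
  else (0%N, 0%N).

Lemma start0 : start 0 = 0%N. Proof. by rewrite /start big_ord0. Qed.
Lemma startS s : start s.+1 = (start s + len s)%N.
Proof. by rewrite /start big_ord_recr. Qed.

Lemma leq_start : {homo start : m n / (m <= n)%N}.
Proof.
by apply: homo_leq => [//|? ? ?|n]; [exact: leq_trans|rewrite startS leq_addr].
Qed.

Hypothesis len_gt0 : forall s, (0 < len s)%N.

Lemma leq_id_start s : (s <= start s)%N.
Proof.
by elim: s => // s IH; rewrite startS; have := len_gt0 s; lia.
Qed.

Lemma locate_start s i : (i < len s)%N -> locate (start s + i) = (s, i).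
Proof.
elim: s i => [|s IHs]; elim=> [|i IHi] hi.
- by rewrite start0.
- by rewrite addnS /= IHi ?hi // ltnW.
- have -> : (start s.+1 + 0 = (start s + (len s).-1).+1)%N.
    by rewrite startS addn0 -addnS prednK.
  by rewrite /= IHs ?prednK // ltnn.
- by rewrite addnS /= IHi ?hi // ltnW.
Qed.

Lemma locateP n : ((locate n).2 < len (locate n).1)%N /\
  n = (start (locate n).1 + (locate n).2)%N.
Proof.
elim: n => [|n [h1 h2]]; first by rewrite /= start0.
rewrite /=; case: ifP => h /=; split=> //.
- by rewrite addnS -h2.
- by rewrite startS addn0 {1}h2; move: h1 h; lia.
Qed.

Lemma sum_start (V : nmodType) (f : nat -> V) s s' : (s <= s')%N ->
  \sum_(start s <= k < start s') f k =
  \sum_(s <= i < s') \sum_(start i <= k < start i.+1) f k.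
Proof.
elim: s' => [|s' IH] h.
  by move: h; rewrite leqn0 => /eqP->; rewrite !big_geq.
have [e|ne] := eqVneq s s'.+1; first by rewrite e !big_geq.
have {ne} h' : (s <= s')%N by move: h ne; lia.
rewrite big_nat_recr // -IH // [LHS](big_cat_nat (n := start s')) //.
  exact: leq_start.
exact/leq_start/leqW.
Qed.

Lemma sum_block (V : nmodType) (f : nat -> V) s :
  \sum_(start s <= k < start s.+1) f k = \sum_(i < len s) f (start s + i)%N.
Proof.
rewrite startS -{1}[start s]add0n big_addn addKn big_mkord.
by apply: eq_bigr => i _; rewrite addnC.
Qed.

(** The terms being nonnegative, the sum may be prolonged to the end of a later block; what remains
    is a geometric series of ratio 1/2. *)
Lemma geometric_tail (R : realType) (f : nat -> R) (C : R) :
  (forall k, 0 <= f k) ->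
  (forall s, \sum_(start s <= k < start s.+1) f k <= C / 2 ^+ s) ->
  forall s n, \sum_(start s <= k < n) f k <= 2 * C / 2 ^+ s.
Proof.
move=> f0 hf s n.
have p2 m : 0 < 2 ^+ m :> R by rewrite exprn_gt0.
have C0 : 0 <= C.
  have := hf 0%N; rewrite expr0 divr1; apply: le_trans.
  by apply: sumr_ge0.
(* The subtracted term is the room kept for the later blocks; it makes the induction close. *)
have step m : \sum_(start s <= k < start (s + m)) f k
      <= 2 * C / 2 ^+ s - 2 * C / 2 ^+ (s + m).
  rewrite sum_start ?leq_addr //; elim: m => [|m IH].
    by rewrite addn0 big_geq // subrr.
  rewrite addnS big_nat_recr ?leq_addr //=.
  have := hf (s + m)%N; move: IH; rewrite exprS.
  set A := \sum_(_ <= i < s + m) _; set B := \sum_(_ <= k < _) _.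
  have -> : 2 * C / (2 * 2 ^+ (s + m)) = C / 2 ^+ (s + m).
    by field; rewrite gt_eqF.
  rewrite -!mulrA; set c := C / _; set d := C / _; lra.
apply: (@le_trans _ _ (\sum_(start s <= k < start (s + n)) f k)); last first.
  apply: (le_trans (step n)); rewrite lerBlDr lerDl.
  by rewrite divr_ge0 ?mulr_ge0 // ltW.
have hn : (n <= start (s + n))%N.
  by apply: leq_trans (leq_id_start _); rewrite leq_addl.
have [h|h] := leqP (start s) n; last first.
  by rewrite big_geq ?(ltnW h) // sumr_ge0.
by rewrite [X in _ <= X](big_cat_nat (n := n)) //= lerDl sumr_ge0.
Qed.

End Concatenation.

(** * The parametrized unit circle *)

Section Circle.
Variable R : realType.
Implicit Types t s : R.

Lemma normc_zT t : normc (zT t) = 1.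
Proof. by rewrite /zT /= cos2Dsin2 sqrtr1. Qed.

Lemma zT_conjM s t : conjc (zT s) * zT t = zT (t - s).
Proof.
rewrite /zT mulrBr cosB sinB; apply/eqP; rewrite eq_complex /=.
by apply/andP; split; apply/eqP; ring.
Qed.

Lemma zTD1 t : zT (t + 1) = zT t.
Proof.
by rewrite /zT mulrDr mulr1 [2 * pi]mulr_natl cosD2pi sinD2pi.
Qed.

End Circle.

(** The closed form of the geometric sum is used multiplied out, so that [u = 1] is no special
    case. *)
Lemma geometric_sum_bound (R : realType) (u : R[i]) l : normc u = 1 ->
  normc (1 - u) * normc (\sum_(k < l) u ^+ k) <= 2.
Proof.
move=> hu; have e : (1 - u) * \sum_(k < l) u ^+ k = 1 - u ^+ l.
  elim: l => [|l IH]; first by rewrite big_ord0 mulr0 expr0 subrr.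
  by rewrite big_ord_recr mulrDr IH exprS; ring.
rewrite -normcM e; apply: (le_trans (le_normcB _ _)).
by rewrite normc1 normcX hu expr1n; lra.
Qed.

(* In the application q, p (resp. q', p') are the values of Phi^* at the centre
   of the block and at the point of evaluation, before (resp. after) the block:
   the term [k' * d] of the expansion carries the gain. *)
Lemma block_gain_estimate (R : realType) (lb m l k k' d : R)
    (w G U B q p q' p' F : R[i]) :
  w * F = l%:C * (k'%:C * (conjc q' * p') - k%:C * (conjc q * p)) - G * U * B ->
  normc B <= 12 / 5 -> normc U = 1 -> q' = q + d%:C ->
  w != 0 -> 1 <= l -> 0 <= m -> 0 <= lb -> m * l <= 1 / 32 ->
  1 <= k' <= 17 / 16 -> k <= k' <= k + 5 / 2 * (m ^+ 2 * l) ->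
  225 / 256 * (m * l) <= d ->
  normc q <= 17 / 16 -> normc p <= 17 / 16 -> normc (p' - 1) <= 1 / 16 ->
  normc w * normc (p' - p) <= 5 * m -> normc w * normc G <= 2 ->
  1 / 2 / normc w <= complex.Im w^-1 ->
  lb / normc w * (m * l / 4 - 11 / l / normc w) <=
    complex.Im ((lb / l)%:C * F).
Proof.
move=> eF hB hU eq' w0 l1 m0 lb0 ml /andP[k1 k1'] /andP[kd kd'] hd q1 p1 p2.
have r0 : 0 < normc w by rewrite normc_gt0.
have l0 : 0 < l by apply: lt_le_trans l1.
move=> eta hG; set r := normc w in r0 eta hG *.
have {}eta : normc (p' - p) <= 5 * m / r by rewrite ler_pdivlMr // mulrC.
have {}hG : normc G <= 2 / r by rewrite ler_pdivlMr // mulrC.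
move=> hc.
have ml0 : 0 <= m * l by rewrite mulr_ge0 // ltW.
have d0 : 0 <= d by lra.
have kM0 : 0 <= k' by apply: le_trans k1.
(* With [q' = q + d], the bracket of the expansion is [k' * d] plus three errors: the distance of
   [p'] from 1, the change of [p], and the change of [k]. *)
pose E : R[i] := (k' * d)%:C * (p' - 1) + k'%:C * (conjc q * (p' - p))
  + (k' - k)%:C * (conjc q * p).
have hE : normc E <= k' * d * (1 / 16) + 289 / 256 * (5 * m / r)
    + 5 / 2 * (m ^+ 2 * l) * (289 / 256).
  have n1 := normc_ge0 q; have n2 := normc_ge0 p; have n3 := normc_ge0 (p' - p).
  have qp : normc q * normc p <= 17 / 16 * (17 / 16) by apply: ler_pM.
  have kq : k' * normc q <= 17 / 16 * (17 / 16) by apply: ler_pM.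
  have c289 : 17 / 16 * (17 / 16) = 289 / 256 :> R by field.
  apply: (le_trans (le_normcD _ _)); apply: lerD; last first.
    rewrite !normcM normc_conj normc_real ger0_norm ?subr_ge0 //.
    by apply: ler_pM; rewrite ?subr_ge0 ?mulr_ge0 // -?c289 // lerBlDr addrC.
  apply: (le_trans (le_normcD _ _)); apply: lerD.
    by rewrite normcM normc_real ger0_norm ?ler_wpM2l // mulr_ge0.
  rewrite !normcM normc_conj normc_real ger0_norm // mulrA -c289.
  by apply: ler_pM => //; rewrite mulr_ge0.
have lc : l%:C != 0 :> R[i] by rewrite -normc_gt0 normc_real ger0_norm // ltW.
(* Only the first summand needs its imaginary part, which [hc] bounds below; all the rest is bounded
   by its modulus. *)
have {}eF : (lb / l)%:C * F = lb%:C * ((k' * d)%:C * w^-1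
    + w^-1 * (E - l%:C^-1 * (G * U * B))).
  have -> : F = w^-1 * (w * F) by rewrite mulKf.
  have -> : (lb / l)%:C = lb%:C * l%:C^-1.
    by rewrite real_complexM; congr (_ * _); exact: fmorphV.
  have -> : w * F = l%:C * (k'%:C * ((conjc q + d%:C) * p') - k%:C * (conjc q * p))
      - G * U * B.
    rewrite eF eq'; congr (_ * (_ * (_ * _) - _) - _).
    by rewrite -[in RHS](conjc_real d); exact: rmorphD.
  rewrite /E !real_complexM.
  have -> : (k' - k)%:C = k'%:C - k%:C by exact: rmorphB.
  by field; rewrite lc w0.
rewrite eF Im_realM Im_add Im_realM -[lb / r * _]mulrA ler_wpM2l //.
set T := w^-1 * _.
have hT : normc T <= r^-1 * (normc E + l^-1 * (2 / r * (12 / 5))).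
  rewrite /T normcM normcV ler_wpM2l ?invr_ge0 ?(ltW r0) //.
  apply: (le_trans (le_normcB _ _)); rewrite lerD2l.
  rewrite normcM normcV normc_real ger0_norm ?(ltW l0) //.
  rewrite ler_wpM2l ?invr_ge0 ?(ltW l0) //.
  rewrite 2!normcM hU mulr1.
  by apply: ler_pM; rewrite ?normc_ge0.
have := normc_ge_absIm T; rewrite ler_norml => /andP[hIm _].
have rr0 : 0 < r^-1 by rewrite invr_gt0.
have li0 : 0 < l^-1 by rewrite invr_gt0.
have m1 : m <= 1 / 32 * l^-1 by rewrite ler_pdivlMr.
have kdl : 225 / 256 * (m * l) <= k' * d.
  by apply: (le_trans hd); rewrite ler_peMl.
have m3 : m ^+ 2 * l <= 1 / 32 * (m * l).
  rewrite expr2 -mulrA ler_wpM2r ?mulr_ge0 ?(ltW l0) //.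
  by apply: (le_trans m1); rewrite ler_piMr // invf_le1.
have mr : m / r <= 1 / 32 * (l^-1 / r) by rewrite mulrA ler_wpM2r // ltW.
have lr0 : 0 <= l^-1 / r by rewrite mulr_ge0 // ltW.
(* Since [m <= 1 / (32 l)], the change of [p] costs a multiple of [1 / (l r)] and joins the
   oscillating term, while [m^2 l] becomes a small multiple of [m l]. *)
have hX : normc E + l^-1 * (2 / r * (12 / 5)) <=
   k' * d * (1 / 16) + 1 / 8 * (m * l) + 11 / l / r.
  have e1 : l^-1 * (2 / r * (12 / 5)) = 24 / 5 * (l^-1 / r) by field; rewrite !gt_eqF.
  have e2 : 11 / l / r = 11 * (l^-1 / r) by field; rewrite !gt_eqF.
  have e3 : 5 * m / r = 5 * (m / r) by rewrite mulrA.
  move: hE mr lr0 ml0 m3; rewrite e1 e2 e3; clear.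
  move: (normc E) (l^-1 / r) (m / r) (m * l) (m ^+ 2 * l) (k' * d) => *; lra.
have hY : r^-1 * (normc E + l^-1 * (2 / r * (12 / 5))) <=
   r^-1 * (k' * d * (1 / 16) + 1 / 8 * (m * l) + 11 / l / r).
  by rewrite ler_wpM2l // ltW.
have hZ : k' * d * (1 / 2 / r) <= k' * d * complex.Im w^-1.
  by rewrite ler_wpM2l // mulr_ge0.
have hW : 0 <= r^-1 * (k' * d - 225 / 256 * (m * l)).
  by rewrite mulr_ge0 ?subr_ge0 // ltW.
have hV : 0 <= r^-1 * (m * l) by rewrite mulr_ge0 // ltW.
have : - (r^-1 * (k' * d * (1 / 16) + 1 / 8 * (m * l) + 11 / l / r)) <= complex.Im T.
  by apply: le_trans hIm; rewrite lerN2; apply: le_trans hT hY.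
(* The numerical margin is [(1/2 - 1/16) * 225/256 - 1/8 >= 1/4]. *)
move: hZ hW hV; clear.
move: (m * l) (k' * d) (complex.Im T) (complex.Im _) => ? ? ? ?; lra.
Qed.

(** * The Szego recursion driven block by block *)

Section SzegoBlocks.
Variables (R : realType) (L : nat -> nat) (tb mb : nat -> R) (V : nat -> R -> R).
Hypothesis L_gt0 : forall b, (0 < L b)%N.
Hypothesis mb_ge0 : forall b, 0 <= mb b.
Hypothesis V_ge0 : forall b t, 0 <= V b t.
(** [V b t] is to majorize a sum of at most [L b] kernels: the first case is the trivial bound, each
    kernel being at most 6/5, and the second is the Christoffel-Darboux bound [5 / |1 - u|]. *)
Hypothesis V_cover : forall b t,
  2 * (L b)%:R <= V b t \/ 5 <= V b t * normc (1 - zT (t - tb b)).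
Hypothesis sum_V : forall B t, \sum_(0 <= b < B) mb b * V b t <= 1 / 16.
Hypothesis sum_mb2 : forall B, \sum_(0 <= b < B) mb b ^+ 2 * (L b)%:R <= 1 / 64.

(** On the outer thirds the coefficients vanish, so [Phis] and [ksq] are constant there; this leaves
    room for the two ramps of the cut-off. *)
Definition blen b := (3 * L b)%N.
Local Notation st := (start blen).

Definition bpoint n : R[i] := zT (tb (locate blen n).1).
Definition bmu n : R := let p := locate blen n in
  if (L p.1 <= p.2 < 2 * L p.1)%N then mb p.1 else 0.

Local Notation k2 := (ksq bpoint bmu).
Local Notation P := (Phi bpoint bmu).
Local Notation Q := (Phis bpoint bmu).
Local Notation kn := (kern bpoint bmu).
Local Notation cdn := (cd bpoint bmu).
Local Notation v := (verb bpoint bmu).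

Lemma blen_gt0 b : (0 < blen b)%N.
Proof. by rewrite muln_gt0 L_gt0. Qed.

Lemma bmu_ge0 n : 0 <= bmu n.
Proof. by rewrite /bmu; case: ifP. Qed.

Lemma bpoint_start b i : (i < blen b)%N -> bpoint (st b + i) = zT (tb b).
Proof. by move=> hi; rewrite /bpoint (locate_start blen_gt0). Qed.

Lemma bmu_start b i : (i < blen b)%N ->
  bmu (st b + i) = if (L b <= i < 2 * L b)%N then mb b else 0.
Proof. by move=> hi; rewrite /bmu (locate_start blen_gt0). Qed.

Lemma sum_bmu2_block b :
  \sum_(st b <= k < st b.+1) bmu k ^+ 2 = mb b ^+ 2 * (L b)%:R.
Proof.
rewrite sum_block.
under eq_bigr => i _ do rewrite bmu_start //.
rewrite -(big_mkord xpredT (fun i => (if (L b <= i < 2 * L b)%N then mb b else 0) ^+ 2)).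
have hL : (L b <= 2 * L b <= blen b)%N by rewrite /blen; lia.
rewrite (big_cat_nat (n := L b)) //=; last by rewrite /blen; lia.
rewrite [X in _ + X](big_cat_nat (n := 2 * L b)) //=; [|by rewrite /blen; lia..].
rewrite [X in X + _]big_nat_cond big1 => [|i]; last first.
  by rewrite andbT => /andP[_ hi]; rewrite leqNgt hi /= expr0n.
rewrite [X in _ + (_ + X)]big_nat_cond [X in _ + (_ + X)]big1 => [|i]; last first.
  by rewrite andbT => /andP[hi _]; rewrite [(i < _)%N]ltnNge hi andbF expr0n.
rewrite add0r addr0.
under eq_big_nat => i hi do rewrite hi.
rewrite sumr_const_nat mulr_natr; congr (_ *+ _); lia.
Qed.

Lemma sum_bmu2 n : \sum_(0 <= k < n) bmu k ^+ 2 <= 1 / 64.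
Proof.
have hn : (n <= st n)%N by exact: (leq_id_start blen_gt0).
apply: (@le_trans _ _ (\sum_(st 0 <= k < st n) bmu k ^+ 2)).
  rewrite start0 [X in _ <= X](big_cat_nat (n := n)) //= lerDl.
  by apply: sumr_ge0 => i _; rewrite sqr_ge0.
rewrite sum_start //.
by under eq_bigr do rewrite sum_bmu2_block.
Qed.

(** The invariant of the strong induction in [all_good]. The bound on [ksq] is put on its inverse,
    the product of the [1 - |a_j|^2], because that loses only a sum of squares. *)
Definition good n := 
  [/\ (forall t, normc ((Q n).[zT t] - 1) <= 1 / 16),
   1 <= k2 n & 1 - 2 * \sum_(0 <= k < n) bmu k ^+ 2 <= (k2 n)^-1].

Lemma good_ksq n : good n -> 1 <= k2 n <= 17 / 16.
Proof.
case=> _ h1 h2; rewrite h1 /=.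
have hy : 31 / 32 <= (k2 n)^-1.
  by apply: le_trans h2; have := sum_bmu2 n; set s := \sum_(_ <= _ < _) _; lra.
have k0 : 0 < k2 n by apply: lt_le_trans h1.
have : k2 n * (k2 n)^-1 = 1 by rewrite divff ?gt_eqF.
by move: hy; set y := (k2 n)^-1 => hy e; nra.
Qed.

Lemma good_Phis n t : good n -> normc (Q n).[zT t] <= 17 / 16.
Proof.
case=> h _ _; rewrite -[(Q n).[zT t]](subrK 1).
apply: (le_trans (le_normcD _ _)); rewrite normc1; have := h t; lra.
Qed.

Lemma good_Phis_ge n t : good n -> 15 / 16 <= normc (Q n).[zT t].
Proof.
case=> h _ _; have := h t; have := le_normcB (Q n).[zT t] ((Q n).[zT t] - 1).
by rewrite opprB addrC subrK normc1; lra.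
Qed.

Lemma normc_Phi_zT n t : normc (P n).[zT t] = normc (Q n).[zT t].
Proof. by rewrite normc_Phi // normc_zT. Qed.

Lemma good_mul3 n s t : good n ->
  k2 n * (normc (Q n).[zT s] * normc (Q n).[zT t]) <= 6 / 5.
Proof.
move=> g; have /andP[a1 a2] := good_ksq g.
have b1 := good_Phis s g; have b2 := good_Phis t g.
have c1 := normc_ge0 (Q n).[zT s]; have c2 := normc_ge0 (Q n).[zT t].
have h : normc (Q n).[zT s] * normc (Q n).[zT t] <= 17 / 16 * (17 / 16).
  exact: ler_pM.
have h0 : 0 <= normc (Q n).[zT s] * normc (Q n).[zT t] by rewrite mulr_ge0.
have k0 : 0 <= k2 n by lra.
by have := ler_pM k0 h0 a2 h; lra.
Qed.

Lemma good_kern n s t : good n -> normc (kn n (zT s) (zT t)) <= 6 / 5.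
Proof.
move=> g; have /andP[a1 _] := good_ksq g.
rewrite /kern !normcM normc_conj normc_real ger0_norm; last lra.
by rewrite !normc_Phi_zT; exact: good_mul3.
Qed.

Lemma good_verb n : good n -> normc (v n) ^+ 2 <= 2 * bmu n ^+ 2.
Proof.
move=> g; have /andP[a1 a2] := good_ksq g.
rewrite normc_verb ?normc_zT ?bmu_ge0 //; last lra.
rewrite /bpoint normc_Phi_zT; have b1 := good_Phis (tb (locate blen n).1) g.
have := normc_ge0 (Q n).[zT (tb (locate blen n).1)].
move: b1; set q := normc _ => b1 b0.
rewrite -mulrA exprMn [2 * _]mulrC ler_wpM2l ?sqr_ge0 //.
have h : k2 n * q <= 17 / 16 * (17 / 16) by apply: ler_pM => //; lra.
have h0 : 0 <= k2 n * q by rewrite mulr_ge0 //; lra.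
by have := ler_pM h0 h0 h h; rewrite -expr2; lra.
Qed.

Lemma good_verb_lt1 n : good n -> normc (v n) < 1.
Proof.
move=> g; have := good_verb g; have := sum_bmu2 n.+1.
rewrite big_nat_recr //=.
have : 0 <= \sum_(0 <= i < n) bmu i ^+ 2 by apply: sumr_ge0 => i _; rewrite sqr_ge0.
have := normc_ge0 (v n); set x := normc _; set s := \sum_(_ <= _ < _) _; nra.
Qed.

Lemma good_cd n s t : good n -> normc (cdn n (zT s) (zT t)) <= 12 / 5.
Proof.
move=> g; have /andP[a1 _] := good_ksq g.
rewrite /cd normcM normc_real ger0_norm; last lra.
have := le_normcB (conjc (Q n).[zT s] * (Q n).[zT t]) (conjc (P n).[zT s] * (P n).[zT t]).
rewrite !normcM !normc_conj !normc_Phi_zT => h.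
have k0 : 0 <= k2 n by lra.
apply: (le_trans (ler_wpM2l k0 h)); rewrite mulrDr.
by have := good_mul3 s t g; lra.
Qed.

(** By [cdS], [cd] at [n.+1] can be written with the polynomials of index [n]. Hence a telescoped
    sum is controlled without goodness at its upper end, which is not yet known during the
    induction. *)
Lemma good_cdS n s t : good n -> normc (cdn n.+1 (zT s) (zT t)) <= 12 / 5.
Proof.
move=> g; have /andP[a1 _] := good_ksq g.
rewrite cdS ?good_verb_lt1 //.
have -> : cdn n (zT s) (zT t) + (1 - conjc (zT s) * zT t) * kn n (zT s) (zT t) =
  (k2 n)%:C * (conjc (Q n).[zT s] * (Q n).[zT t])
   - conjc (zT s) * zT t * kn n (zT s) (zT t) by rewrite /cd /kern; ring.
apply: (le_trans (le_normcB _ _)).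
have := good_kern s t g; move: (kn n (zT s) (zT t)) => K hK.
rewrite !normcM !normc_conj !normc_zT normc_real ger0_norm ?mul1r; last lra.
have := good_mul3 s t g; lra.
Qed.

Lemma sum_kern (N M : nat) x z : (N <= M)%N -> (forall k, (k < M)%N -> good k) ->
  (1 - conjc x * z) * \sum_(N <= k < M) kn k x z = cdn M x z - cdn N x z.
Proof.
elim: M => [|M IH] h g.
  by move: h; rewrite leqn0 => /eqP->; rewrite big_geq // mulr0 subrr.
have [e|ne] := eqVneq N M.+1; first by rewrite e big_geq // mulr0 subrr.
have h' : (N <= M)%N by move: h ne; lia.
rewrite big_nat_recr // mulrDr IH // => [|k hk]; last by apply: g; rewrite ltnW.
rewrite (cdS x z (good_verb_lt1 (g M (ltnSn _)))); ring.
Qed.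

Lemma sum_kern_bound N M s t : (N <= M)%N -> (forall k, (k < M)%N -> good k) ->
  normc (1 - zT (t - s)) * normc (\sum_(N <= k < M) kn k (zT s) (zT t)) <= 5.
Proof.
move=> h g; rewrite -normcM -zT_conjM sum_kern //.
case: M h g => [|M] h g.
  by move: h; rewrite leqn0 => /eqP->; rewrite subrr normc0.
have [->|ne] := eqVneq N M.+1; first by rewrite subrr normc0.
apply: (le_trans (le_normcB _ _)).
have := good_cdS s t (g M (ltnSn _)).
have := good_cd s t (g N _); rewrite ltn_neqAle ne h => /(_ isT); lra.
Qed.

Lemma sum_kern_triv N M s t : (N <= M)%N -> (forall k, (k < M)%N -> good k) ->
  normc (\sum_(N <= k < M) kn k (zT s) (zT t)) <= 6 / 5 * (M - N)%:R.
Proof.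
move=> h g; apply: (le_trans (le_normc_sum _ _ _)).
rewrite big_nat; apply: (@le_trans _ _ (\sum_(N <= i < M) 6 / 5)).
  rewrite [X in _ <= X]big_nat; apply: ler_sum => i /andP[_ hi]; exact/good_kern/g.
by rewrite sumr_const_nat mulr_natr.
Qed.

(** Only the middle third moves [Phis]; [maxn] and [minn] clip the range, which is empty on the left
    third and complete on the right one. *)
Lemma Phis_block b i z : (i <= blen b)%N ->
  (Q (st b + i)).[z] - (Q (st b)).[z] =
  (mb b)%:C * (conjc (zT (tb b)) * z *
  \sum_(st b + L b <= k < maxn (st b + L b) (st b + minn i (2 * L b))) kn k (zT (tb b)) z).
Proof.
elim: i => [|i IH] hi.
  by rewrite addn0 subrr min0n addn0 big_geq ?mulr0 // geq_max leqnn /= leq_addr.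
rewrite addnS PhisS_kern bpoint_start // bmu_start // addrAC IH ?(ltnW hi) //.
case: ifP => [/andP[h1 h2]|h].
  rewrite (minn_idPl (ltnW h2)) (minn_idPl h2).
  rewrite (maxn_idPr _) ?leq_add2l // (maxn_idPr _) ?leq_add2l ?leqW //.
  rewrite addnS big_nat_recr ?leq_add2l //=; ring.
rewrite mul0r addr0; congr (_ * (_ * _)).
have [h1|h1] := ltnP i (L b).
  by rewrite !big_geq //; lia.
have h2 : (2 * L b <= i)%N by move: h; rewrite h1 /= => /negbT; rewrite -leqNgt.
by rewrite (minn_idPr h2) (minn_idPr (leqW h2)).
Qed.

(** The two cases of [V_cover] are matched with [sum_kern_triv] and [sum_kern_bound]. *)
Lemma Phis_block_bound b i t : (i <= blen b)%N ->
  (forall k, (k < st b + i)%N -> good k) ->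
  normc ((Q (st b + i)).[zT t] - (Q (st b)).[zT t]) <= mb b * V b t.
Proof.
move=> hi g; rewrite Phis_block // !normcM normc_conj !normc_zT !mul1r.
rewrite normc_real ger0_norm //; apply: ler_wpM2l => //.
set M := maxn _ _.
have [hM|hM] := leqP M (st b + L b).
  by rewrite big_geq // normc0.
have eM : M = (st b + minn i (2 * L b))%N by move: hM; rewrite /M; lia.
have gM : forall k, (k < M)%N -> good k.
  by move=> k hk; apply: g; move: hk; rewrite eM; lia.
have h0 := normc_ge0 (\sum_(st b + L b <= k < M) kn k (zT (tb b)) (zT t)).
case: (V_cover b t) => hV.
  apply: le_trans hV; apply: (le_trans (sum_kern_triv _ _ (ltnW hM) gM)).
  have : (M - (st b + L b))%:R <= (L b)%:R :> R by rewrite ler_nat eM; lia.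
  have : 0 <= (L b)%:R :> R by []. 
  lra.
have := sum_kern_bound (tb b) t (ltnW hM) gM.
have := normc_ge0 (1 - zT (t - tb b)); have := V_ge0 b t.
move: hV h0; move: (normc (\sum_(_ <= _ < _) _)) (normc (1 - _)) (V b t) => s a w {hM gM eM M}.
move=> wa s0 w0 a0 as5; rewrite leNgt; apply/negP => ws.
have a1 : 0 < a by rewrite ltNge; apply/negP => a2; nra.
nra.
Qed.

Lemma Phis_start_bound B : (forall k, (k < st B)%N -> good k) ->
  forall t, normc ((Q (st B)).[zT t] - 1) <= \sum_(0 <= b < B) mb b * V b t.
Proof.
elim: B => [|B IH] g t; first by rewrite start0 hPhis0 subrr normc0 big_geq.
rewrite big_nat_recr //= [X in _ <= X]addrC startS.
have -> : (Q (st B + blen B)).[zT t] - 1 =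
  ((Q (st B + blen B)).[zT t] - (Q (st B)).[zT t]) + ((Q (st B)).[zT t] - 1).
  ring.
apply: (le_trans (le_normcD _ _)); apply: lerD.
  by apply: Phis_block_bound => // k hk; apply: g; rewrite startS.
by apply: IH => k hk; apply: g; apply: (leq_trans hk); exact: leq_start.
Qed.

(** The increments of [Phis] up to index [n] only involve kernels of smaller index, so goodness
    below [n] and [sum_V] keep [Phis] near 1; the bounds on [ksq] follow from [|a|^2 <= 2 mu^2]. *)
Lemma all_good n : good n.
Proof.
elim/ltn_ind: n => n IH; split.
- move=> t; have [h1 h2] := locateP blen_gt0 n.
  move: h1 h2; set b := (locate _ _).1; set i := (locate _ _).2 => h1 h2.
  have -> : (Q n).[zT t] - 1 =
    ((Q (st b + i)).[zT t] - (Q (st b)).[zT t]) + ((Q (st b)).[zT t] - 1).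
    by rewrite -h2; ring.
  apply: (le_trans (le_normcD _ _)); apply: le_trans (sum_V b.+1 t).
  rewrite big_nat_recr //= [X in X <= _]addrC; apply: lerD.
    by apply: Phis_start_bound => k hk; apply: IH; rewrite h2; lia.
  by apply: Phis_block_bound; [exact: ltnW|move=> k; rewrite -h2; exact: IH].
- case: n IH => [|n] IH; first by rewrite ksq0.
  have g := IH n (ltnSn _); have := good_verb_lt1 g.
  have := normc_ge0 (v n); have /andP[] := good_ksq g; rewrite ksqS.
  set x := normc _ => k1 _ x0 x1; rewrite ler_pdivlMr; nra.
- case: n IH => [|n] IH; first by rewrite ksq0 big_geq // mulr0 subr0 invr1.
  have g := IH n (ltnSn _); rewrite ksqS invf_div big_nat_recr //=.
  have lt1 := good_verb_lt1 g.
  have gv := good_verb g; case: (g) => _ k1 hy; move: hy gv lt1.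
  have : 0 < (k2 n)^-1 by rewrite invr_gt0; lra.
  have : (k2 n)^-1 <= 1 by rewrite invf_le1; lra.
  have := normc_ge0 (v n).
  set y := (k2 n)^-1; set x := normc _; set s := \sum_(_ <= _ < _) _.
  set m := bmu n ^+ 2; nra.
Qed.

Lemma ksq_bounds n : 1 <= k2 n <= 17 / 16.
Proof. exact/good_ksq/all_good. Qed.

Lemma ksqV_lb N M : (N <= M)%N ->
  (k2 N)^-1 - 2 * \sum_(N <= k < M) bmu k ^+ 2 <= (k2 M)^-1 <= (k2 N)^-1.
Proof.
elim: M => [|M IH] h.
  by move: h; rewrite leqn0 => /eqP->; rewrite big_geq // mulr0 subr0 lexx.
have [->|ne] := eqVneq N M.+1; first by rewrite big_geq // mulr0 subr0 lexx.
have {ne} h' : (N <= M)%N by move: h ne; lia.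
rewrite big_nat_recr //= ksqS invf_div.
have lt1 := good_verb_lt1 (all_good M); have gv := good_verb (all_good M).
have /andP[k1 _] := ksq_bounds M.
have : 0 < (k2 M)^-1 by rewrite invr_gt0; lra.
have : (k2 M)^-1 <= 1 by rewrite invf_le1; lra.
move: (IH h') lt1 gv; have := normc_ge0 (v M).
set y := (k2 M)^-1; set x := normc _; set s := \sum_(_ <= _ < _) _.
by set m := bmu M ^+ 2 => a /andP[b b'] c d e f; apply/andP; split; nra.
Qed.

Lemma ksq_const N i : (forall j, (j < i)%N -> bmu (N + j) = 0) ->
  k2 (N + i) = k2 N.
Proof.
elim: i => [|i IH] h; first by rewrite addn0.
rewrite addnS ksqS IH => [|j hj]; last exact/h/ltnW.
by rewrite verbE h // mul0r oppr0 !mul0r normc0 expr0n subr0 divr1.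
Qed.

Lemma ksq_left b i : (i <= L b)%N -> k2 (st b + i) = k2 (st b).
Proof.
move=> hi; apply: ksq_const => j hj; rewrite bmu_start /blen; last lia.
by case: ifP => //; lia.
Qed.

Lemma ksq_right b i : (i <= L b)%N -> k2 (st b + 2 * L b + i) = k2 (st b + 2 * L b).
Proof.
move=> hi; apply: ksq_const => j hj; rewrite -addnA bmu_start /blen; last lia.
by case: ifP => //; lia.
Qed.

Lemma Phis_left b i z : (i <= L b)%N -> (Q (st b + i)).[z] = (Q (st b)).[z].
Proof.
move=> hi; apply/eqP; rewrite -subr_eq0 Phis_block /blen; last lia.
by rewrite big_geq ?mulr0 //; lia.
Qed.

Lemma Phis_middle b z : (Q (st b + 2 * L b)).[z] = (Q (st b)).[z] +
  (mb b)%:C * (conjc (zT (tb b)) * z *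
  \sum_(st b + L b <= k < st b + 2 * L b) kn k (zT (tb b)) z).
Proof.
apply/eqP; rewrite addrC -subr_eq Phis_block /blen; last lia.
by rewrite minnn (maxn_idPr _) //; lia.
Qed.

Lemma Phis_right b i z : (i <= L b)%N ->
  (Q (st b + 2 * L b + i)).[z] = (Q (st b + 2 * L b)).[z].
Proof.
move=> hi; rewrite Phis_middle; apply/eqP; rewrite addrC -subr_eq -addnA.
rewrite Phis_block /blen; last lia.
by rewrite (minn_idPr _) ?(maxn_idPr _) //; lia.
Qed.

(** On the circle [Phi] is a power times the conjugate of [Phis], so the whole oscillation in [n]
    sits in the factor [u ^ n], with [u = zT (t - s)]. *)
Lemma cd_zT n s t : cdn n (zT s) (zT t) = (k2 n)%:C *
  (conjc (Q n).[zT s] * (Q n).[zT t]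
   - zT (t - s) ^+ n * ((Q n).[zT s] * conjc (Q n).[zT t])).
Proof.
rewrite /cd !Phi_Phis ?normc_zT // -zT_conjM rmorphM rmorphXn /= conjcK exprMn.
ring.
Qed.

(** The average of the indicators of [l] shifted windows of length [2 l]: it climbs on the left
    third, is 1 on the middle third and descends on the right one. As an average of windows it turns
    a weighted kernel sum into an average of telescoping sums. *)
Definition trapezoid (l i : nat) : R := (\sum_(k < l) (k <= i < 2 * l + k)%N)%:R / l%:R.

Variable lb : nat -> R.

Definition blam n : R := let p := locate blen n in lb p.1 * trapezoid (L p.1) p.2.

Lemma block_sum b z :
  \sum_(st b <= n < st b.+1) (blam n)%:C * kn n (bpoint n) z =
  (lb b / (L b)%:R)%:C * \sum_(k < L b)
     \sum_(st b + k <= n < st b + 2 * L b + k) kn n (zT (tb b)) z.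
Proof.
rewrite sum_block mulr_sumr.
transitivity (\sum_(i < blen b) \sum_(k < L b) (lb b / (L b)%:R)%:C *
    ((k <= i < 2 * L b + k)%N%:R * kn (st b + i) (zT (tb b)) z)).
  apply: eq_bigr => i _; rewrite bpoint_start // /blam (locate_start blen_gt0) //=.
  rewrite -mulr_sumr -mulr_suml -natr_sum /trapezoid.
  rewrite [_ * (_ / _)]mulrCA [_ * (lb b / _)]mulrC real_complexM -mulrA.
  by congr (_ * (_ * _)); exact: rmorph_nat.
rewrite exchange_big; apply: eq_bigr => k _; rewrite -mulr_sumr; congr (_ * _).
rewrite -(big_mkord xpredT (fun i => (k <= i < 2 * L b + k)%N%:R * kn (st b + i) (zT (tb b)) z)).
have kL := ltn_ord k.
rewrite (big_cat_nat (n := k)) //=; last by rewrite /blen; lia.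
rewrite [X in _ + X](big_cat_nat (n := 2 * L b + k)) //=; [|by rewrite /blen; lia..].
rewrite [X in X + _]big_nat [X in X + _]big1 => [|i /andP[_ hi]]; last first.
  by rewrite leqNgt hi mul0r.
rewrite [X in _ + (_ + X)]big_nat [X in _ + (_ + X)]big1 => [|i /andP[hi _]]; last first.
  by rewrite [(i < _)%N]ltnNge hi andbF mul0r.
rewrite add0r addr0 -addnA [(st b + k)%N]addnC big_addn.
have -> : (st b + (2 * L b + k) - st b = 2 * L b + k)%N by lia.
by apply: eq_big_nat => i hi; rewrite hi mul1r addnC.
Qed.

(** Each window begins in the left third and ends in the right third, where [Phis] and [ksq] are
    constant. So only the power of [u] depends on the shift [k], and averaging leaves a geometric
    sum: this is what damps the oscillating part of the kernel sum. *)
Lemma cd_sum_block b t (u := zT (t - tb b)) (N := st b) (M := (st b + 2 * L b)%N)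
    (x := zT (tb b)) (z := zT t) :
  (1 - u) * \sum_(k < L b) \sum_(N + k <= n < M + k) kn n x z =
  (L b)%:R%:C * ((k2 M)%:C * (conjc (Q M).[x] * (Q M).[z])
           - (k2 N)%:C * (conjc (Q N).[x] * (Q N).[z]))
  - (\sum_(k < L b) u ^+ k) * u ^+ N *
    ((k2 M)%:C * u ^+ (2 * L b) * ((Q M).[x] * conjc (Q M).[z])
     - (k2 N)%:C * ((Q N).[x] * conjc (Q N).[z])).
Proof.
have -> : (L b)%:R%:C = \sum_(k < L b) 1 :> R[i].
  by rewrite sumr_const card_ord; exact: rmorph_nat.
rewrite mulr_sumr !mulr_suml -sumrB; apply: eq_bigr => k _.
have kL := ltnW (ltn_ord k).
rewrite {1}/u -zT_conjM sum_kern; last 2 first.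
- by rewrite leq_add2r leq_addr.
- by move=> n _; exact: all_good.
rewrite /M /N /x /z !cd_zT !(Phis_right _ kL) !(Phis_left _ kL).
rewrite (ksq_right kL) (ksq_left kL) -/u !exprD; ring.
Qed.

Lemma kern_diag n s : kn n (zT s) (zT s) = (k2 n * normc (Q n).[zT s] ^+ 2)%:C.
Proof. by rewrite real_complexM -normc_Phi_zT sqr_normc_mulJ. Qed.

(** At the centre itself all kernels are positive, at least [(15/16)^2 = 225/256], so the increments
    add up without cancellation. *)
Lemma Phis_middle_diag b (M := (st b + 2 * L b)%N) : exists2 d : R,
  225 / 256 * (mb b * (L b)%:R) <= d &
  (Q M).[zT (tb b)] = (Q (st b)).[zT (tb b)] + d%:C.
Proof.
exists (mb b * \sum_(st b + L b <= n < M) k2 n * normc (Q n).[zT (tb b)] ^+ 2).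
  rewrite mulrCA ler_wpM2l //.
  have -> : 225 / 256 * (L b)%:R = \sum_(st b + L b <= n < M) 225 / 256 :> R.
    rewrite sumr_const_nat -[RHS]mulr_natr; congr (_ * _%:R).
    by rewrite /M; lia.
  apply: ler_sum => n _; have /andP[a1 _] := ksq_bounds n.
  have a2 := good_Phis_ge (tb b) (all_good n).
  have q0 : 0 <= 15 / 16 :> R by lra.
  have a3 := ler_pM q0 q0 a2 a2; rewrite -expr2 in a3.
  have c0 : 0 <= 15 / 16 * (15 / 16) :> R by lra.
  by have := ler_pM ler01 c0 a1 a3; lra.
rewrite Phis_middle [conjc _ * _]mulrC normc1_conjV ?normc_zT // mul1r.
rewrite real_complexM; congr (_ + _ * _).
under eq_bigr => n _ do rewrite kern_diag.
by rewrite [in RHS](rmorph_sum (real_complex R)).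
Qed.

Lemma Phis_middle_bound b t :
  normc (1 - zT (t - tb b)) *
  normc ((Q (st b + 2 * L b)).[zT t] - (Q (st b)).[zT t]) <= 5 * mb b.
Proof.
rewrite Phis_middle [_ + _ - (Q _).[_]]addrC addKr !normcM normc_conj !normc_zT !mul1r.
rewrite normc_real ger0_norm // mulrCA mulrC ler_wpM2r //.
apply: sum_kern_bound => [|n _]; last exact: all_good.
by rewrite leq_add2l leq_pmull.
Qed.

Lemma ksq_middle b : k2 (st b) <= k2 (st b + 2 * L b) <=
  k2 (st b) + 5 / 2 * (mb b ^+ 2 * (L b)%:R).
Proof.
have /andP[y1 y2] : (k2 (st b))^-1 - 2 * (mb b ^+ 2 * (L b)%:R)
    <= (k2 (st b + 2 * L b))^-1 <= (k2 (st b))^-1.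
  have h1 : (st b <= st b + 2 * L b)%N by rewrite leq_addr.
  have h2 : (st b + 2 * L b <= st b.+1)%N.
    by rewrite startS leq_add2l /blen leq_mul2r orbT.
  have /andP[y1 ->] := ksqV_lb h1; rewrite andbT; apply: le_trans y1.
  rewrite lerD2l lerN2 ler_wpM2l // -sum_bmu2_block.
  rewrite [X in _ <= X](big_cat_nat (n := (st b + 2 * L b)%N)) //= lerDl.
  by apply: sumr_ge0 => i _; rewrite sqr_ge0.
have [/andP[k1 k1'] /andP[l1 l1']] := (ksq_bounds (st b), ksq_bounds (st b + 2 * L b)).
have e1 : k2 (st b) * (k2 (st b))^-1 = 1 by rewrite divff // gt_eqF // (lt_le_trans ltr01).
have e2 : k2 (st b + 2 * L b) * (k2 (st b + 2 * L b))^-1 = 1.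
  by rewrite divff // gt_eqF // (lt_le_trans ltr01).
have m0 : 0 <= mb b ^+ 2 * (L b)%:R by rewrite mulr_ge0 ?sqr_ge0.
move: y1 y2 e1 e2 m0 k1 k1' l1 l1'; move: (mb b ^+ 2 * _) => m.
move: (k2 (st b)) (k2 (st b + _)) (k2 (st b))^-1 (k2 (st b + _))^-1 => {b} k k' y y' y1 y2 e1 e2 m0 k1 k1' l1 l1'.
(* Passes from the inverses back to [ksq]; the constant 5/2 is [5/4 * 2]. *)
have d : k' - k = k * k' * (y - y').
  by transitivity (k * y * k' - (k' * y') * k); [rewrite e1 e2; ring|ring].
have kk : k * k' <= 5 / 4.
  have : k * k' <= 17 / 16 * (17 / 16) by apply: ler_pM; lra.
  lra.
have kk0 : 0 <= k * k' by apply: mulr_ge0; lra.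
have d0 : 0 <= y - y' by lra.
have d1 : y - y' <= 2 * m by lra.
have := ler_pM kk0 d0 kk d1; rewrite -d.
have := mulr_ge0 kk0 d0; rewrite -d.
by move=> ? ?; apply/andP; split; lra.
Qed.

Lemma cd_sum_block_osc b t (u := zT (t - tb b)) (N := st b) (M := (st b + 2 * L b)%N)
    (x := zT (tb b)) (z := zT t) :
  normc ((k2 M)%:C * u ^+ (2 * L b) * ((Q M).[x] * conjc (Q M).[z])
     - (k2 N)%:C * ((Q N).[x] * conjc (Q N).[z])) <= 12 / 5.
Proof.
apply: (le_trans (le_normcB _ _)).
have [/andP[k1 _] /andP[l1 _]] := (ksq_bounds N, ksq_bounds M).
rewrite !normcM !normcX normc_zT expr1n !normc_conj !normc_real mulr1.
rewrite !ger0_norm ?(le_trans ler01) //.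
have := good_mul3 (tb b) t (all_good N); have := good_mul3 (tb b) t (all_good M).
by rewrite -/x -/z -/N -/M; lra.
Qed.

Lemma block_gain b t (r := normc (1 - zT (t - tb b))) :
  0 <= lb b -> mb b * (L b)%:R <= 1 / 32 -> 0 < r ->
  1 / 2 / r <= complex.Im (1 - zT (t - tb b))^-1 ->
  lb b / r * (mb b * (L b)%:R / 4 - 11 / (L b)%:R / r) <=
  complex.Im (\sum_(st b <= n < st b.+1) (blam n)%:C * kn n (bpoint n) (zT t)).
Proof.
move=> lb0 he r0 hc; rewrite block_sum.
have u1 : 1 - zT (t - tb b) != 0 by rewrite -normc_gt0.
have L1 : 1 <= (L b)%:R :> R by rewrite ler1n.
have /andP[k1 k1'] := ksq_bounds (st b + 2 * L b).
have /andP[_ k0'] := ksq_bounds (st b).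
have /andP[kd kd'] := ksq_middle b.
have [d hd ed] := Phis_middle_diag b.
have q1 := good_Phis (tb b) (all_good (st b)).
have p1 := good_Phis t (all_good (st b)).
have p2 : normc ((Q (st b + 2 * L b)).[zT t] - 1) <= 1 / 16.
  by have [h _ _] := all_good (st b + 2 * L b).
have eta := Phis_middle_bound b t.
have hG := geometric_sum_bound (L b) (normc_zT (t - tb b)).
have h1 := cd_sum_block b t; have h2 := cd_sum_block_osc b t; cbv zeta in h1, h2.
have hU : normc (zT (t - tb b) ^+ st b) = 1 by rewrite normcX normc_zT expr1n.
by apply: (block_gain_estimate h1 h2 hU ed) => //; apply/andP; split.
Qed.

(** Whole blocks are summed, then one partial block. The upper limit [n.+1] is crude but safe, as a
    block number never exceeds the indices in the block. *)
Lemma Phis_tail B n t : (st B <= n)%N ->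
  normc ((Q n).[zT t] - (Q (st B)).[zT t]) <= \sum_(B <= b < n.+1) mb b * V b t.
Proof.
move=> hB.
have full d : normc ((Q (st (B + d))).[zT t] - (Q (st B)).[zT t])
    <= \sum_(B <= b < B + d) mb b * V b t.
  elim: d => [|d IH]; first by rewrite addn0 subrr normc0 big_geq.
  rewrite addnS big_nat_recr ?leq_addr //= startS.
  have -> : (Q (st (B + d) + blen (B + d))).[zT t] - (Q (st B)).[zT t] =
    ((Q (st (B + d) + blen (B + d))).[zT t] - (Q (st (B + d))).[zT t])
    + ((Q (st (B + d))).[zT t] - (Q (st B)).[zT t]) by ring.
  apply: (le_trans (le_normcD _ _)); rewrite [X in _ <= X]addrC; apply: lerD => //.
  by apply: Phis_block_bound => // k _; exact: all_good.
have [h1 h2] := locateP blen_gt0 n.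
move: h1 h2; set b := (locate _ _).1; set i := (locate _ _).2 => h1 h2.
have Bb : (B <= b)%N.
  rewrite leqNgt; apply/negP => /(leq_start blen) hb.
  by move: hB; rewrite h2 leqNgt; apply/negP/negPn; apply: leq_trans hb; rewrite startS ltn_add2l.
have bn : (b <= n)%N.
  by rewrite h2; apply: (leq_trans (leq_id_start blen_gt0 b)); rewrite leq_addr.
have -> : (Q n).[zT t] - (Q (st B)).[zT t] =
    ((Q (st b)).[zT t] - (Q (st B)).[zT t])
    + ((Q (st b + i)).[zT t] - (Q (st b)).[zT t]) by rewrite -h2; ring.
apply: (le_trans (le_normcD _ _)).
apply: (@le_trans _ _ (\sum_(B <= c < b.+1) mb c * V c t)).
  rewrite big_nat_recr //=; apply: lerD.
    by have := full (b - B)%N; rewrite subnKC.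
  by apply: Phis_block_bound; [exact: ltnW|move=> k _; exact: all_good].
rewrite [X in _ <= X](big_cat_nat (n := b.+1)) //=; last by rewrite leqW.
by rewrite lerDl; apply: sumr_ge0 => c _; rewrite mulr_ge0.
Qed.

Lemma Phis_cvg t :
  (forall e, 0 < e -> exists B, forall n, \sum_(B <= b < n) mb b * V b t <= e) ->
  cvgn (fun n => normc (Q n).[zT t]).
Proof.
move=> tail; apply/cauchy_cvgP; apply/cauchy_exP => e e0.
have e2 : 0 < e / 2 by lra.
have [B hB] := tail (e / 2) e2.
exists (normc (Q (st B)).[zT t]); exists (st B) => // n /= hn.
rewrite /ball /=; have h := le_trans (Phis_tail t hn) (hB n.+1).
apply: (@le_lt_trans _ _ (e / 2)); last lra.
apply: le_trans h; rewrite ler_norml; apply/andP; split.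
  have := le_normcD ((Q n).[zT t] - (Q (st B)).[zT t]) (Q (st B)).[zT t].
  by rewrite subrK; lra.
have := le_normcB (Q n).[zT t] ((Q n).[zT t] - (Q (st B)).[zT t]).
by rewrite opprB addrC subrK; lra.
Qed.

Lemma trapezoid_bound l i : 0 <= trapezoid l i <= 1.
Proof.
rewrite /trapezoid divr_ge0 //=.
have [->|l0] := posnP l; first by rewrite big_ord0 mul0r.
rewrite ler_pdivrMr ?ltr0n // mul1r ler_nat.
apply: (@leq_trans (\sum_(k < l) 1)); first by apply: leq_sum => k _; case: (_ && _).
by rewrite sum1_card card_ord.
Qed.

Lemma sum_blam2 n : \sum_(0 <= k < n) blam k ^+ 2
  <= \sum_(0 <= b < n) (3 * (L b)%:R) * lb b ^+ 2.
Proof.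
have hn : (n <= st n)%N by exact: (leq_id_start blen_gt0).
apply: (@le_trans _ _ (\sum_(st 0 <= k < st n) blam k ^+ 2)).
  rewrite start0 [X in _ <= X](big_cat_nat (n := n)) //= lerDl.
  by apply: sumr_ge0 => i _; rewrite sqr_ge0.
rewrite sum_start //; apply: ler_sum => b _; rewrite sum_block.
have -> : 3 * (L b)%:R * lb b ^+ 2 = \sum_(i < blen b) lb b ^+ 2.
  by rewrite sumr_const card_ord -[RHS]mulr_natl /blen natrM.
apply: ler_sum => i _; rewrite /blam (locate_start blen_gt0) //= exprMn.
have /andP[t0 t1] := trapezoid_bound (L b) i.
rewrite ler_piMr ?sqr_ge0 //; exact: exprn_ile1.
Qed.

End SzegoBlocks.

(** * Elementary bounds for sine, cosine and [1 - zT s] *)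

Section TrigBounds.
Variable R : realType.
Implicit Types (x s t : R).

Lemma sin_mvt x : 0 < x -> exists2 c, 0 < c < x & sin x = cos c * x.
Proof.
move=> x0; have [c] := @MVT R sin cos 0 x x0 (fun y _ => is_derive_sin y)
  (continuous_subspaceT (@continuous_sin R)).
by rewrite in_itv /= sin0 !subr0 => h e; exists c.
Qed.

Lemma sin_le_id x : 0 <= x -> sin x <= x.
Proof.
rewrite le_eqVlt => /predU1P[<-|x0]; first by rewrite sin0.
have [c _ ->] := sin_mvt x0; rewrite ger_pMl //; exact: cos_le1.
Qed.

Lemma cos_ge_half x : 0 <= x <= 1 -> 1 / 2 <= cos x.
Proof.
move=> /andP[x0 x1]; have e : x = (x / 2) *+ 2 by rewrite -mulr_natr divfK.
have y0 : 0 <= x / 2 by rewrite divr_ge0.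
have h1 := sin_le_id y0.
have h0 : 0 <= sin (x / 2).
  by apply: sin_ge0_pi; rewrite y0 /=; have := @pi_ge2 R; lra.
have -> : cos x = (1 - sin (x / 2) ^+ 2) * 2 - 1.
  by rewrite {1}e cos_mulr2n cos2sin2 mulr_natr.
nra.
Qed.

Lemma sin_ge_half x : 0 <= x <= 1 -> x / 2 <= sin x.
Proof.
move=> /andP[x0 x1]; move: x0; rewrite le_eqVlt => /predU1P[<-|x0].
  by rewrite sin0 mul0r.
have [c /andP[c0 cx] ->] := sin_mvt x0.
have : 1 / 2 <= cos c by apply: cos_ge_half; apply/andP; split; lra.
nra.
Qed.

Lemma sin_ge_quarter x : 0 <= x <= pi / 2 -> x / 4 <= sin x.
Proof.
move=> /andP[x0 x1]; have [h|h] := leP x 1.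
  have : x / 2 <= sin x by apply: sin_ge_half; rewrite x0.
  lra.
have p2 : pi / 2 < 2 :> R := @pihalf_lt2 R.
have p1 : 1 <= pi / 2 :> R := @pihalf_ge1 R.
have h1 : 1 / 2 <= sin 1 :> R by apply: sin_ge_half; rewrite ler01 lexx.
have : sin 1 < sin x by rewrite ltr_sin // in_itv /=; apply/andP; split; lra.
lra.
Qed.

Lemma normc_1BzT s : 0 <= s <= 1 -> normc (1 - zT s) = 2 * sin (pi * s).
Proof.
move=> /andP[s0 s1]; have p0 : 0 < pi :> R := pi_gt0 R.
have h0 : 0 <= sin (pi * s).
  by apply: sin_ge0_pi; rewrite mulr_ge0 ?(ltW p0) //= ler_piMr // ltW.
apply/eqP; rewrite -(eqrXn2 (n := 2)) ?normc_ge0 ?mulr_ge0 // sqr_normcE; apply/eqP.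
have e : 2 * pi * s = (pi * s) *+ 2 by rewrite -mulr_natr; ring.
rewrite /zT /= e cos_mulr2n sin_mulr2n sub0r.
have := cos2Dsin2 (pi * s); move: (cos _) (sin _) => a b h.
have ha : a ^+ 2 = 1 - b ^+ 2 by rewrite -h addrK.
have -> : (- ((a * b) *+ 2)) ^+ 2 = 4 * (a ^+ 2 * b ^+ 2) by ring.
by rewrite ha; ring.
Qed.

Lemma normc_1BzT_ge s : 0 <= s <= 1 / 2 -> s <= normc (1 - zT s).
Proof.
move=> /andP[s0 s1]; rewrite normc_1BzT; last by apply/andP; split; lra.
have p2 := @pi_ge2 R.
have : pi * s / 4 <= sin (pi * s) by apply: sin_ge_quarter; apply/andP; split; nra.
nra.
Qed.

Lemma normc_1BzT_ge' s : 1 / 2 <= s <= 1 -> 1 - s <= normc (1 - zT s).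
Proof.
move=> /andP[s0 s1].
have : 1 - s <= normc (1 - zT (1 - s)) by apply: normc_1BzT_ge; apply/andP; split; lra.
rewrite !normc_1BzT ?(mulrBr, mulr1) ?subr_ge0; [|by apply/andP; split; lra..].
by rewrite sinB sinpi cospi mul0r sub0r mulN1r opprK.
Qed.

Lemma normc_1BzT_le s : 0 <= s <= 1 -> normc (1 - zT s) <= 8 * s.
Proof.
move=> h; rewrite normc_1BzT //; case/andP: h => s0 s1.
have p2 : pi / 2 < 2 :> R := @pihalf_lt2 R; have p0 := pi_gt0 R.
have : sin (pi * s) <= pi * s by apply: sin_le_id; rewrite mulr_ge0 // ltW.
nra.
Qed.

(** The imaginary part is [cot (pi s) / 2] and the modulus is [2 sin (pi s)], so the claim amounts
    to [cos (pi s) >= 1/2]. This common sign for all centres on one side of the point prevents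
    cancellation between blocks. *)
Lemma Im_inv_1BzT s : 0 < s <= 1 / 4 ->
  1 / 2 / normc (1 - zT s) <= complex.Im (1 - zT s)^-1.
Proof.
move=> /andP[s0 s1].
have r0 : 0 < normc (1 - zT s).
  by apply: (lt_le_trans s0); apply: normc_1BzT_ge; apply/andP; split; lra.
have -> : complex.Im (1 - zT s)^-1 = sin (2 * pi * s) / normc (1 - zT s) ^+ 2.
  by rewrite sqr_normcE /zT /= !sub0r mulNr opprK.
rewrite expr2 invfM mulrA ler_wpM2r ?invr_ge0 ?(ltW r0) // ler_pdivlMr //.
have p2 : pi / 2 < 2 :> R := @pihalf_lt2 R; have p0 := pi_gt0 R.
have e : 2 * pi * s = (pi * s) *+ 2 by rewrite -mulr_natr; ring.
rewrite normc_1BzT; last by apply/andP; split; lra.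
rewrite e sin_mulr2n -mulr_natr.
have : 1 / 2 <= cos (pi * s) by apply: cos_ge_half; apply/andP; split; nra.
have : 0 <= sin (pi * s) by apply: sin_ge0_pi; apply/andP; split; nra.
nra.
Qed.

Lemma zTBn t n : zT (t - n%:R) = zT t.
Proof.
elim: n => [|n IH]; first by rewrite subr0.
by rewrite -IH -[in RHS](subrK 1 t) -natr1 opprD addrA -[in RHS]addrAC zTD1 addrAC.
Qed.

Lemma zTBz t (k : int) : zT (t - k%:~R) = zT t.
Proof.
case: k => n; first exact: zTBn.
by rewrite NegzE mulrNz opprK -[in RHS](addrK (n.+1%:R) t) zTBn.
Qed.

End TrigBounds.

(** * Harmonic sums *)

Section Harmonic.
Variable R : realType.

Definition hsum n : R := \sum_(0 <= i < n) i.+1%:R^-1.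

Lemma hsum_ge0 n : 0 <= hsum n.
Proof. by apply: sumr_ge0 => i _; rewrite invr_ge0. Qed.

Lemma hsum_mono : {homo hsum : m n / (m <= n)%N >-> m <= n}.
Proof.
move=> m n h; rewrite /hsum [X in _ <= X](big_cat_nat (n := m)) //= lerDl.
by apply: sumr_ge0 => i _; rewrite invr_ge0.
Qed.

(** The eight terms following index [8 (m + 1)] add at most [1 / (m + 1)], the next term of
    [hsum]. *)
Lemma hsum_mul8 m : hsum (8 * m.+1) <= 8 + hsum m.
Proof.
have step k n : (0 < k)%N ->
    hsum (k + n) <= hsum k + n%:R * k%:R^-1.
  move=> k0; elim: n => [|n IH]; first by rewrite addn0 mul0r addr0.
  rewrite addnS /hsum big_nat_recr //= -/(hsum _) -[n.+1%:R]natr1 mulrDl mul1r addrA.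
  apply: lerD => //; rewrite lef_pV2 ?posrE ?ltr0n // ler_nat; lia.
elim: m => [|m IH].
  have h1 : hsum 1 = 1 by rewrite /hsum big_nat1 invr1.
  have h0 : hsum 0 = 0 by rewrite /hsum big_geq.
  have h8 : hsum 8 <= hsum 1 + 7 * 1^-1 := step 1%N 7%N isT.
  by rewrite muln1 h0; move: h8; rewrite h1 invr1; lra.
have -> : (8 * m.+2 = 8 * m.+1 + 8)%N by lia.
apply: (le_trans (step _ _ _)) => //.
rewrite {2}/hsum big_nat_recr //= -/(hsum _) addrA; apply: lerD => //.
rewrite natrM invfM mulrA divff ?mul1r // pnatr_eq0.
Qed.

Lemma hsum_unbounded (A : R) : exists m, A <= hsum m.
Proof.
apply: contrapT => h; have bd n : hsum n <= A.
  by apply/ltW; rewrite ltNge; apply/negP => ?; apply: h; exists n.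
apply: (@dvg_harmonic R); apply: nondecreasing_is_cvgn.
  by apply/nondecreasing_seqP => n; rewrite !seriesEnat /= big_nat_recr //= lerDl.
by exists A => _ [n _ <-]; rewrite seriesEnat; exact: bd.
Qed.

Lemma sum_invsqr n : \sum_(i < n) (i.+1%:R ^+ 2)^-1 <= 2 :> R.
Proof.
(* The sharper bound telescopes through [1 / (a + 1)^2 <= 1 / a - 1 / (a + 1)]. *)
suff : \sum_(i < n.+1) (i.+1%:R ^+ 2)^-1 <= 2 - n.+1%:R^-1 :> R.
  have : 0 <= (n.+1%:R : R)^-1 by rewrite invr_ge0.
  rewrite big_ord_recr /=; have : 0 <= ((n.+1%:R : R) ^+ 2)^-1 by rewrite invr_ge0 exprn_ge0.
  set x := (_ ^+ 2)^-1; set y := _^-1; set z := \sum_(i < n) _; lra.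
elim: n => [|n IH]; first by rewrite big_ord_recr big_ord0 /= expr1n invr1; lra.
rewrite big_ord_recr /=; move: IH; set S := \sum_(i < n.+1) _.
have a0 : 0 < n.+1%:R :> R by rewrite ltr0n.
rewrite -[n.+2%:R]natr1; move: (n.+1%:R : R) a0 => a a0 IH.
have : ((a + 1) ^+ 2)^-1 <= a^-1 - (a + 1)^-1; last by lra.
have -> : a^-1 - (a + 1)^-1 = (a * (a + 1))^-1 by field; rewrite !gt_eqF //; lra.
rewrite lef_pV2 ?posrE ?mulr_gt0 ?exprn_gt0 //; try lra.
Qed.

End Harmonic.

(** [j] to [i0 - j] permutes the residues modulo [J]; adding [J] first keeps the subtraction of
    naturals exact. *)
Lemma sum_modn_shift (R : realType) J i0 (G : nat -> R) : (0 < J)%N ->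
  \sum_(0 <= j < J) G ((i0 + J - j) %% J)%N = \sum_(0 <= d < J) G d.
Proof.
case: J => // J _; rewrite !big_mkord.
pose h (j : 'I_J.+1) : 'I_J.+1 := inord ((i0 + J.+1 - j) %% J.+1).
have hv (j : 'I_J.+1) : h j = ((i0 + J.+1 - j) %% J.+1)%N :> nat.
  by rewrite /h inordK // ltn_mod.
rewrite [RHS](reindex_inj (h := h)) => [|i j /(congr1 val) /=]; last first.
  rewrite !hv => e; apply/val_inj => /=.
  have [hi hj] := (ltn_ord i, ltn_ord j).
  have : (i0 + J.+1 - i + (i + j) = i0 + J.+1 - j + (i + j) %[mod J.+1])%N.
    by rewrite -modnDml e modnDml.
  have -> : (i0 + J.+1 - i + (i + j) = j + i0 + J.+1)%N by lia.
  have -> : (i0 + J.+1 - j + (i + j) = i + i0 + J.+1)%N by lia.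
  rewrite !modnDr => /eqP; rewrite eqn_modDr => /eqP.
  by rewrite !modn_small.
by apply: eq_bigr => j _; rewrite hv.
Qed.

Lemma sum_double_mod (R : realType) J (G : nat -> R) :
  \sum_(0 <= j < 2 * J) G (j %% J)%N = 2 * \sum_(0 <= j < J) G j.
Proof.
have [->|J0] := posnP J; first by rewrite muln0 !big_geq // mulr0.
rewrite (big_cat_nat (n := J)) //=; last lia.
have -> : 2 * \sum_(0 <= j < J) G j = \sum_(0 <= j < J) G j + \sum_(0 <= j < J) G j by ring.
congr (_ + _).
  by apply: eq_big_nat => j /andP[_ hj]; rewrite modn_small.
rewrite -{1}[J]add0n big_addn (_ : 2 * J - J = J)%N; last lia.
by apply: eq_big_nat => j /andP[_ hj]; rewrite modnDr modn_small.
Qed.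

(** * Position of a point among equally spaced centres *)

Section Residue.
Variable R : realType.
Implicit Types t : R.

(* The index d such that t - j / J lies in [d/J, (d+1)/J) modulo 1. *)
Definition slot (J j : nat) t : nat :=
  ((Num.truncn ((t - (Num.floor t)%:~R) * J%:R) + J - j) %% J)%N.

Lemma frac_itv t : 0 <= t - (Num.floor t)%:~R < 1.
Proof.
rewrite subr_ge0 floor_le /= ltrBlDl.
by have := lt_succ_floor t; rewrite intrD.
Qed.

Lemma slotP J j t : (0 < J)%N -> (j < J)%N -> exists2 s : R,
  (slot J j t)%:R / J%:R <= s < (slot J j t).+1%:R / J%:R & zT (t - j%:R / J%:R) = zT s.
Proof.
move=> J0 jJ; have Jr : 0 < J%:R :> R by rewrite ltr0n.
have /andP[f0 f1] := frac_itv t; rewrite /slot.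
set f := t - _ in f0 f1 *.
have ef : zT (t - j%:R / J%:R) = zT (f - j%:R / J%:R).
  by rewrite -(zTBz _ (Num.floor t)) /f; congr zT; ring.
have fJ0 : 0 <= f * J%:R by rewrite mulr_ge0 // ltW.
have /andP[i1 i2] := truncn_itv fJ0; set i0 := Num.truncn _ in i1 i2 *.
have iJ : (i0 < J)%N by rewrite -(ltr_nat R) (le_lt_trans i1) // gtr_pMl.
have [h|h] := leqP j i0.
  have -> : ((i0 + J - j) %% J = i0 - j)%N.
    by rewrite (_ : i0 + J - j = i0 - j + J)%N ?modnDr ?modn_small //; lia.
  exists (f - j%:R / J%:R) => //.
  rewrite ler_pdivrMr // ltr_pdivlMr // mulrBl divfK ?gt_eqF //.
  by rewrite -subSn // !natrB ?leqW //; apply/andP; split; lra.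
have -> : ((i0 + J - j) %% J = i0 + J - j)%N by rewrite modn_small //; lia.
(* Here the difference of angles is negative and is moved forward by one full turn. *)
exists (f - j%:R / J%:R + 1); last by rewrite zTD1.
rewrite ler_pdivrMr // ltr_pdivlMr // mulrDl mulrBl divfK ?gt_eqF // mul1r.
rewrite -subSn; last lia.
rewrite !natrB; [|lia..]; rewrite -addSn !natrD.
by apply/andP; split; lra.
Qed.

(** At [d] slots from a centre the inverse distance is about [J / d]; in the centre's own slot it is
    unbounded and the block length takes its place. *)
Definition gslot (L J d : nat) : R := if d is 0%N then L%:R else J%:R / d%:R.

Lemma gslot_ge0 L J d : 0 <= gslot L J d.
Proof. by case: d => [|d] //=; rewrite divr_ge0. Qed.

Lemma sum_gslot L J : \sum_(0 <= d < J) gslot L J d <= L%:R + J%:R * hsum R J.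
Proof.
case: J => [|J]; first by rewrite big_geq // mul0r addr0.
rewrite big_nat_recl //= lerD2l.
apply: (@le_trans _ _ (J.+1%:R * hsum R J)); last first.
  by rewrite ler_wpM2l // hsum_mono.
by rewrite /hsum mulr_sumr.
Qed.

(** The centre may be nearer along either arc, so both are counted: one lies [d] slots away, the
    other [J - d - 1]. *)
Definition vbound (L J j : nat) t : R :=
  5 * (gslot L J (slot J j t) + gslot L J (J - (slot J j t).+1)).

Lemma vbound_ge0 L J j t : 0 <= vbound L J j t.
Proof. by rewrite mulr_ge0 // addr_ge0 // gslot_ge0. Qed.

Lemma vbound_cover L J j t : (0 < J)%N -> (j < J)%N ->
  2 * L%:R <= vbound L J j t \/
  5 <= vbound L J j t * normc (1 - zT (t - j%:R / J%:R)).
Proof.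
move=> J0 jJ; have [s /andP[s1 s2] ->] := slotP t J0 jJ.
have Jr : 0 < J%:R :> R by rewrite ltr0n.
have dJ : (slot J j t < J)%N by rewrite ltn_mod.
have L0 : 0 <= L%:R :> R by [].
rewrite /vbound; move: (slot J j t) s1 s2 dJ => d s1 s2 dJ.
have g0 := gslot_ge0 L J.
have s_ge0 : 0 <= s by apply: le_trans s1; rewrite divr_ge0.
have s_lt1 : s < 1.
  by apply: (lt_le_trans s2); rewrite ler_pdivrMr // mul1r ler_nat.
have [h|h] := leP s (1 / 2).
  case: d s1 s2 dJ => [|d] s1 s2 dJ.
    by left; have := g0 (J - 1)%N; rewrite /=; lra.
  right; have sr : s <= normc (1 - zT s) by apply: normc_1BzT_ge; rewrite s_ge0.
  have d0 : 0 < d.+1%:R :> R by rewrite ltr0n.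
  have h1 : 1 <= gslot L J d.+1 * normc (1 - zT s).
    apply: (@le_trans _ _ (J%:R / d.+1%:R * (d.+1%:R / J%:R))).
      by rewrite mulrA divfK ?gt_eqF // divff ?gt_eqF.
    by rewrite ler_wpM2l ?divr_ge0 // (le_trans s1).
  have h2 := mulr_ge0 (g0 (J - d.+2)%N) (normc_ge0 (1 - zT s)).
  by rewrite -mulrA mulrDl; move: h1 h2; lra.
case e : (J - d.+1)%N => [|k].
  by left; have := g0 d; rewrite /=; lra.
right; have sr : 1 - s <= normc (1 - zT s).
  by apply: normc_1BzT_ge'; rewrite (ltW h) ltW.
have k0 : 0 < k.+1%:R :> R by rewrite ltr0n.
have ks : k.+1%:R / J%:R <= 1 - s.
  have : k.+1%:R / J%:R + d.+1%:R / J%:R = 1 :> R.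
    by rewrite -mulrDl -natrD (_ : k.+1 + d.+1 = J)%N ?divff ?gt_eqF //; lia.
  by lra.
have h1 : 1 <= gslot L J k.+1 * normc (1 - zT s).
  apply: (@le_trans _ _ (J%:R / k.+1%:R * (k.+1%:R / J%:R))).
    by rewrite mulrA divfK ?gt_eqF // divff ?gt_eqF.
  by rewrite ler_wpM2l ?divr_ge0 // (le_trans ks).
have h2 := mulr_ge0 (g0 d) (normc_ge0 (1 - zT s)).
by rewrite -mulrA mulrDl; move: h1 h2; lra.
Qed.

(** As [j] runs through the residues, so does the slot of [t]. The sum is therefore independent of
    [t], which is where uniformity in the point comes from. *)
Lemma sum_vbound L J t : (0 < J)%N ->
  \sum_(0 <= j < 2 * J) vbound L J (j %% J) t <= 20 * (L%:R + J%:R * hsum R J).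
Proof.
move=> J0; rewrite (sum_double_mod J (fun j => vbound L J j t)).
rewrite /vbound /slot.
rewrite (@sum_modn_shift _ J _ (fun d => 5 * (gslot L J d + gslot L J (J - d.+1)))) //.
rewrite -mulr_sumr big_split /=.
have -> : \sum_(0 <= i < J) gslot L J (J - i.+1) = \sum_(0 <= i < J) gslot L J i.
  by rewrite [RHS]big_nat_rev /=; apply: eq_bigr => i _; rewrite add0n.
have := sum_gslot L J; set S := \sum_(_ <= _ < _) _; set T := _ + _; lra.
Qed.

End Residue.

(** * Means of bounded measurable complex functions over the circle *)

Section BoundedMeasurable.
Variable R : realType.
Local Notation mu := (@lebesgue_measure R).
Local Notation I01 := (`[0%R, 1%R[%classic : set R).
Implicit Types (f g : R -> R[i]) (h : R -> R) (c : R[i]).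

Definition bmeas f := [/\ measurable_fun setT (fun t => complex.Re (f t)),
  measurable_fun setT (fun t => complex.Im (f t)) &
  exists M, forall t, normc (f t) <= M].

Lemma bmeas_cst c : bmeas (fun=> c).
Proof. by split; [exact: measurable_cst..|exists (normc c)]. Qed.

Lemma bmeas_conj f : bmeas f -> bmeas (fun t => conjc (f t)).
Proof.
case=> m1 m2 [M hM]; split.
- by under eq_fun do rewrite /conjc; move: m1; congr (measurable_fun _ _);
    apply: funext => t; case: (f t).
- rewrite (_ : (fun t => _) = (fun t => - complex.Im (f t))).
    exact: measurable_funN m2.
  by apply: funext => t; case: (f t).
- by exists M => t; rewrite normc_conj.
Qed.

Lemma bmeasD f g : bmeas f -> bmeas g -> bmeas (fun t => f t + g t).
Proof.
case=> m1 m2 [M hM] [m3 m4 [M' hM']]; split.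
- by under eq_fun do rewrite Re_add; exact: measurable_funD.
- by under eq_fun do rewrite Im_add; exact: measurable_funD.
- exists (M + M') => t; apply: (le_trans (le_normcD _ _)); exact: lerD.
Qed.

Lemma bmeasM f g : bmeas f -> bmeas g -> bmeas (fun t => f t * g t).
Proof.
case=> m1 m2 [M hM] [m3 m4 [M' hM']]; split.
- under eq_fun do rewrite Re_mul.
  by apply: measurable_funB; exact: measurable_funM.
- under eq_fun do rewrite Im_mul.
  by apply: measurable_funD; exact: measurable_funM.
- by exists (M * M') => t; rewrite normcM; apply: ler_pM; rewrite ?normc_ge0.
Qed.

Lemma bmeas_real h (M : R) : measurable_fun setT h -> (forall t, `|h t| <= M) ->
  bmeas (fun t => (h t)%:C).
Proof.
move=> mh hM; split; [exact: mh|exact: measurable_cst|].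
by exists M => t; rewrite normc_real.
Qed.

Lemma bmeasX f n : bmeas f -> bmeas (fun t => f t ^+ n).
Proof.
move=> bf; elim: n => [|n IH]; first exact: bmeas_cst.
by under eq_fun do rewrite exprS; exact: bmeasM.
Qed.

Lemma bmeas_sum n (f : nat -> R -> R[i]) : (forall i, bmeas (f i)) ->
  bmeas (fun t => \sum_(i < n) f i t).
Proof.
move=> bf; elim: n => [|n IH].
  by under eq_fun do rewrite big_ord0; exact: bmeas_cst.
by under eq_fun do rewrite big_ord_recr; exact: bmeasD.
Qed.

Lemma measurable_cos_lin (a : R) : measurable_fun setT (fun t => cos (a * t)).
Proof.
apply: continuous_measurable_fun => t; apply: continuous_comp.
  by apply: cvgMr; exact: cvg_id.
exact: continuous_cos.
Qed.

Lemma measurable_sin_lin (a : R) : measurable_fun setT (fun t => sin (a * t)).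
Proof.
apply: continuous_measurable_fun => t; apply: continuous_comp.
  by apply: cvgMr; exact: cvg_id.
exact: continuous_sin.
Qed.

Lemma bmeas_zT : bmeas (@zT R).
Proof.
by split; [exact: measurable_cos_lin|exact: measurable_sin_lin|exists 1 => t; rewrite normc_zT].
Qed.

Lemma bmeas_horner (p : {poly R[i]}) : bmeas (fun t => p.[zT t]).
Proof.
under eq_fun do rewrite horner_coef.
by apply: (@bmeas_sum _ (fun i t => p`_i * zT t ^+ i)) => i;
  apply: bmeasM; [exact: bmeas_cst|apply: bmeasX; exact: bmeas_zT].
Qed.

Lemma bmeas_integrable f : bmeas f ->
  mu.-integrable I01 (EFin \o (fun t => complex.Re (f t))) /\
  mu.-integrable I01 (EFin \o (fun t => complex.Im (f t))).
Proof.
case=> m1 m2 [M hM]; have fin : (mu I01 < +oo)%E.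
  by rewrite lebesgue_measure_itv /= lte_fin ltr01 -EFinB ltry.
split; apply: measurable_bounded_integrable => //.
- exact: measurable_funTS.
- exists M; split; rewrite ?num_real // => x Mx y _ /=.
  by apply: le_trans (ltW Mx); apply: le_trans (hM y); exact: normc_ge_absRe.
- exact: measurable_funTS.
- exists M; split; rewrite ?num_real // => x Mx y _ /=.
  by apply: le_trans (ltW Mx); apply: le_trans (hM y); exact: normc_ge_absIm.
Qed.

Definition cmean f : R[i] := Complex (\int[mu]_(t in I01) complex.Re (f t))
  (\int[mu]_(t in I01) complex.Im (f t)).

Lemma eq_cmean f g : f =1 g -> cmean f = cmean g.
Proof. by move=> /funext ->. Qed.

Lemma cmeanD f g : bmeas f -> bmeas g ->
  cmean (fun t => f t + g t) = cmean f + cmean g.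
Proof.
move=> /bmeas_integrable[f1 f2] /bmeas_integrable[g1 g2].
apply/eqP; rewrite eq_complex /=; apply/andP; split; apply/eqP.
- by under eq_Rintegral do rewrite Re_add; exact: RintegralD.
- by under eq_Rintegral do rewrite Im_add; exact: RintegralD.
Qed.

Lemma cmeanZ c f : bmeas f -> cmean (fun t => c * f t) = c * cmean f.
Proof.
move=> bf; have [f1 f2] := bmeas_integrable bf.
have iZ (r : R) h : mu.-integrable I01 (EFin \o h) ->
    mu.-integrable I01 (EFin \o (fun t => r * h t)).
  move=> ih; rewrite (_ : _ \o _ = (fun t => r%:E * (EFin \o h) t)%E).
    exact: integrableZl.
  by apply: funext => t /=; rewrite EFinM.
apply/eqP; rewrite eq_complex Re_mul Im_mul /=; apply/andP; split; apply/eqP.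
- under eq_Rintegral do rewrite Re_mul.
  by rewrite RintegralB ?RintegralZl //; exact: iZ.
- under eq_Rintegral do rewrite Im_mul.
  by rewrite RintegralD ?RintegralZl //; exact: iZ.
Qed.

Lemma cmean_conj f : bmeas f -> cmean (fun t => conjc (f t)) = conjc (cmean f).
Proof.
move=> bf; have [f1 f2] := bmeas_integrable bf.
apply/eqP; rewrite eq_complex /=; apply/andP; split; apply/eqP.
- by apply: eq_Rintegral => t _; case: (f t).
- rewrite -mulN1r -RintegralZl //; apply: eq_Rintegral => t _.
  by rewrite mulN1r; case: (f t).
Qed.

Lemma cmean_sum n (f : nat -> R -> R[i]) : (forall i, bmeas (f i)) ->
  cmean (fun t => \sum_(i < n) f i t) = \sum_(i < n) cmean (f i).
Proof.
move=> bf; elim: n => [|n IH].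
  rewrite big_ord0 (eq_cmean (g := fun=> 0 * 0)).
    by rewrite cmeanZ ?mul0r //; exact: bmeas_cst.
  by move=> t; rewrite big_ord0 mul0r.
rewrite big_ord_recr /= -IH -cmeanD //; last exact: bmeas_sum.
by apply: eq_cmean => t; rewrite big_ord_recr.
Qed.

Lemma mean_cst (c : R) : \int[mu]_(t in I01) c = c.
Proof.
have fin : mu I01 = 1%E.
  by rewrite lebesgue_measure_itv /= lte_fin ltr01 oppr0 adde0.
rewrite Rintegral_cst //; transitivity (c * fine (1%E : \bar R)).
  by congr (_ * fine _); exact: fin.
by rewrite /= mulr1.
Qed.

Lemma mean_le h (M : R) : measurable_fun setT h -> (forall t, `|h t| <= M) ->
  `|\int[mu]_(t in I01) h t| <= M.
Proof.
move=> mh hM; have [ih _] := bmeas_integrable (bmeas_real mh hM).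
apply: (le_trans (le_normr_Rintegral _ ih)) => //.
have [ic _] := bmeas_integrable (bmeas_cst M%:C).
have ma : measurable_fun setT (fun t => `|h t|) by exact: measurableT_comp.
have ha t : Num.norm `|h t| <= M by rewrite normr_id.
have [ia _] := bmeas_integrable (bmeas_real ma ha).
apply: (@le_trans _ _ (\int[mu]_(t in I01) M)); last first.
  by rewrite mean_cst.
by apply: (le_Rintegral _ ia ic) => // t _; exact: hM.
Qed.

(** Real and imaginary parts are bounded separately; the lost factor 2 is harmless for a remainder
    that tends to 0. *)
Lemma cmean_bound f (M : R) : bmeas f -> (forall t, normc (f t) <= M) ->
  normc (cmean f) <= M + M.
Proof.
move=> [m1 m2 _] hM; apply: (le_trans (normc_le_ReIm _)); apply: lerD.
- apply: mean_le => // t; apply: le_trans (hM t); exact: normc_ge_absRe.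
- apply: mean_le => // t; apply: le_trans (hM t); exact: normc_ge_absIm.
Qed.

Lemma cmean_cst c : cmean (fun=> c) = c.
Proof.
by case: c => a b; rewrite /cmean /= !mean_cst.
Qed.

Lemma zTX (t : R) n : zT t ^+ n = zT (n%:R * t).
Proof.
elim: n => [|n IH].
  by rewrite expr0 mul0r /zT mulr0 cos0 sin0.
rewrite exprS IH -natr1 mulrDl mul1r /zT mulrDr cosD sinD.
by apply/eqP; rewrite eq_complex /=; apply/andP; split; apply/eqP; ring.
Qed.

Lemma mean_derive0 (F f : R -> R) : (forall t : R, is_derive t 1 F (f t)) ->
  continuous f -> mu.-integrable I01 (EFin \o f) -> F 0 = F 1 ->
  \int[mu]_(t in I01) f t = 0.
Proof.
move=> dF cf intf F01; rewrite Rintegral_itv_bndo_bndc // /Rintegral.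
have cF : continuous F.
  move=> t; apply: differentiable_continuous; apply/derivable1_diffP.
  by have [] := dF t.
rewrite (@continuous_FTC2 _ f F 0 1) //.
- by rewrite F01 -EFinB subrr.
- exact: continuous_subspaceT.
- split.
  + by move=> t _; have [] := dF t.
  + exact/cvg_at_right_filter/cF.
  + exact/cvg_at_left_filter/cF.
- by move=> t _; rewrite derive1E; have [_ ->] := dF t.
Qed.

(** Real and imaginary parts have the primitives [sin (a t) / a] and [- cos (a t) / a], which agree
    at 0 and 1 because [a] is a multiple of [2 pi]. *)
Lemma cmean_zTX n : (0 < n)%N -> cmean (fun t => zT t ^+ n) = 0.
Proof.
move=> n0; pose a : R := 2 * pi * n%:R.
have a0 : a != 0.
  by rewrite /a !mulf_neq0 ?pnatr_eq0 -?lt0n // gt_eqF // pi_gt0.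
have ea : a = (pi *+ 2) *+ n by rewrite /a mulr_natr mulr_natl.
have cosa : cos a = 1.
  by rewrite ea -[_ *+ n]add0r (periodicn (@cosD2pi R)) cos0.
have sina : sin a = 0.
  by rewrite ea -[_ *+ n]add0r (periodicn (@sinD2pi R)) sin0.
have cl : continuous (fun t : R => a * t) by move=> t; apply: cvgMr; exact: cvg_id.
have dl (t : R) : is_derive t 1 (fun t : R => a * t) a.
  have h : is_derive t (1 : R) (a \*: (id : R -> R)) (a *: (1 : R)) by exact: is_deriveZ.
  by move: h; rewrite [a *: 1]mulr1.
have [i1 i2] := bmeas_integrable (bmeasX n bmeas_zT).
have e t : zT t ^+ n = Complex (cos (a * t)) (sin (a * t)).
  by rewrite zTX /zT /a !mulrA.
rewrite (_ : (fun t => complex.Re _) = fun t => cos (a * t)) in i1; last first.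
  by apply: funext => t; rewrite e.
rewrite (_ : (fun t => complex.Im _) = fun t => sin (a * t)) in i2; last first.
  by apply: funext => t; rewrite e.
apply/eqP; rewrite eq_complex /=; apply/andP; split; apply/eqP.
- transitivity (\int[mu]_(t in I01) cos (a * t)).
    by apply: eq_Rintegral => t _; rewrite e.
  apply: (@mean_derive0 (fun t => a^-1 * sin (a * t))) => //.
  + move=> t; have h := is_derive1_comp (is_derive_sin (a * t)) (dl t).
    have {}h : is_derive t (1 : R) (a^-1 \*: (sin \o (fun t => a * t)))
      (a^-1 *: (cos (a * t) * a)) by exact: is_deriveZ.
    by move: h; rewrite [_ *: _]mulrC mulfK.
  + by move=> t; apply: continuous_comp; [exact: cl|exact: continuous_cos].
  + by rewrite mulr0 sin0 mulr1 sina.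
- transitivity (\int[mu]_(t in I01) sin (a * t)).
    by apply: eq_Rintegral => t _; rewrite e.
  apply: (@mean_derive0 (fun t => - a^-1 * cos (a * t))) => //.
  + move=> t; have h := is_derive1_comp (is_derive_cos (a * t)) (dl t).
    have {}h : is_derive t (1 : R) ((- a^-1) \*: (cos \o (fun t => a * t)))
      (- a^-1 *: (- sin (a * t) * a)) by exact: is_deriveZ.
    by move: h; rewrite [_ *: _]mulrC mulrN mulNr mulNr opprK mulfK.
  + by move=> t; apply: continuous_comp; [exact: cl|exact: continuous_sin].
  + by rewrite mulr0 cos0 mulr1 cosa.
Qed.

Lemma cmean_horner (p : {poly R[i]}) : cmean (fun t => p.[zT t]) = p.[0].
Proof.
rewrite (eq_cmean (g := fun t => \sum_(i < size p) p`_i * zT t ^+ i)); last first.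
  by move=> t; rewrite horner_coef.
rewrite (@cmean_sum _ (fun i t => p`_i * zT t ^+ i)) => [|i]; last first.
  by apply: bmeasM; [exact: bmeas_cst|apply: bmeasX; exact: bmeas_zT].
rewrite horner_coef; apply: eq_bigr => -[[|i] /= hi] _.
  by rewrite (eq_cmean (g := fun=> p`_0)) ?cmean_cst ?expr0 ?mulr1 // => t; rewrite expr0 mulr1.
rewrite cmeanZ ?cmean_zTX ?expr0n //; apply: bmeasX; exact: bmeas_zT.
Qed.

End BoundedMeasurable.

(** * Means of reciprocals of polynomials near 1 *)

Section Recip.
Variable R : realType.

Lemma measurable_invr (h : R -> R) : measurable_fun setT h ->
  (forall t, 0 < h t) -> measurable_fun setT (fun t => (h t)^-1).
Proof.
move=> mh h0; rewrite (_ : (fun t => _) = (fun t => expR (- ln (h t)))).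
  apply: measurableT_comp => //; apply: measurable_funN.
  by apply: measurableT_comp => //; exact: measurable_ln.
by apply: funext => t; rewrite expRN lnK // posrE.
Qed.

Lemma measurable_sqr_normc (f : R -> R[i]) : bmeas f ->
  measurable_fun setT (fun t => normc (f t) ^+ 2).
Proof.
case=> m1 m2 _; under eq_fun do rewrite sqr_normcE.
by apply: measurable_funD; exact: measurable_funX.
Qed.

Lemma bmeas_inv (f : R -> R[i]) (c : R) : 0 < c -> bmeas f ->
  (forall t, c <= normc (f t)) -> bmeas (fun t => (f t)^-1).
Proof.
move=> c0 bf hf; have f0 t : 0 < normc (f t) by apply: lt_le_trans (hf t).
have e t : (f t)^-1 = ((normc (f t) ^+ 2)^-1)%:C * conjc (f t).
  have nz : f t != 0 by rewrite -normc_gt0.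
  have -> : ((normc (f t) ^+ 2)^-1)%:C = ((normc (f t) ^+ 2)%:C)^-1 by exact: fmorphV.
  have nz' : conjc (f t) != 0 by rewrite conjc_eq0.
  by rewrite sqr_normc_mulJ; field; rewrite nz nz'.
under eq_fun do rewrite e.
apply: bmeasM; last exact: bmeas_conj.
apply: (@bmeas_real _ _ ((c ^+ 2)^-1)).
  apply: measurable_invr; first exact: measurable_sqr_normc.
  by move=> t; rewrite exprn_gt0.
move=> t; rewrite ger0_norm ?invr_ge0 ?exprn_ge0 ?(ltW (f0 t)) //.
rewrite lef_pV2 ?posrE ?exprn_gt0 //.
by rewrite ler_pXn2r ?nnegrE ?(ltW c0) ?(ltW (f0 t)).
Qed.

(* Neumann series: |q - 1| <= 1/16 on the circle makes 1/q a uniform limit of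
   polynomials, so no zero-freeness in the disc has to be discussed. *)
Lemma cmean_zTX_div (q : {poly R[i]}) k :
  (forall t, normc (q.[zT t] - 1) <= 1 / 16) -> q.[0] = 1 ->
  cmean (fun t => zT t ^+ k * (q.[zT t])^-1) = (k == 0%N)%:R.
Proof.
move=> hq q0.
have hq1 t : 15 / 16 <= normc q.[zT t].
  have := hq t; have := le_normcB q.[zT t] (q.[zT t] - 1).
  by rewrite opprB addrC subrK normc1; lra.
have qnz t : q.[zT t] != 0 by rewrite -normc_gt0; have := hq1 t; lra.
have c15 : 0 < 15 / 16 :> R by lra.
have bV := bmeas_inv c15 (bmeas_horner q) hq1.
have bz := bmeasX k (bmeas_zT R).
(* [r] is the order at which the Neumann series is truncated; letting it grow gives equality. *)
suff H r : normc (cmean (fun t => zT t ^+ k * (q.[zT t])^-1) - (k == 0%N)%:R)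
    <= 4 * (1 / 16) ^+ r.+1.
  apply/eqP; rewrite -subr_eq0 -normc_eq0 eq_le normc_ge0 andbT.
  apply/ler_addgt0Pl => e e0; rewrite addr0.
  have : geometric 4 (1 / 16 : R) @ \oo --> (0 : R).
    by apply: cvg_geometric; rewrite ger0_norm; lra.
  move/cvgr0Pnorm_lt => /(_ e e0) [N _ /(_ N.+1 (leqnSn N))] /= hN.
  apply: (le_trans (H N)); apply: ltW; apply: le_lt_trans hN; exact: ler_norm.
(* The mean of the polynomial part [p] is its value at 0, and [1 - q] vanishes at 0, so only the
   first term of the Neumann sum counts. *)
pose p : {poly R[i]} := 'X^k * \sum_(i < r.+1) (1 - q) ^+ i.
pose e t : R[i] := zT t ^+ k * (1 - q).[zT t] ^+ r.+1 * (q.[zT t])^-1.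
have geo (x : R[i]) : x * \sum_(i < r.+1) (1 - x) ^+ i = 1 - (1 - x) ^+ r.+1.
  elim: r.+1 => [|n IH]; first by rewrite big_ord0 mulr0 expr0 subrr.
  by rewrite big_ord_recr mulrDr IH exprS; ring.
have he t : zT t ^+ k * (q.[zT t])^-1 = p.[zT t] + e t.
  have : p.[zT t] = zT t ^+ k * \sum_(i < r.+1) (1 - q.[zT t]) ^+ i.
    rewrite /p !hornerE horner_sum; congr (_ * _).
    by apply: eq_bigr => i _; rewrite !hornerE.
  move=> ->; rewrite /e !hornerE.
  have -> : \sum_(i < r.+1) (1 - q.[zT t]) ^+ i =
      (1 - (1 - q.[zT t]) ^+ r.+1) * (q.[zT t])^-1 by rewrite -geo mulrAC mulfV ?mul1r.
  ring.
have be : bmeas e.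
  apply: bmeasM => //; apply: bmeasM => //; apply: bmeasX; exact: bmeas_horner.
rewrite (eq_cmean he) cmeanD //; last exact: bmeas_horner.
rewrite cmean_horner.
have -> : p.[0] = (k == 0%N)%:R.
  rewrite /p !hornerE horner_sum big_ord_recl big1 => [|i _]; last first.
    by rewrite !hornerE q0 subrr expr0n.
  by rewrite expr0 hornerC addr0 mulr1 expr0n.
rewrite [_ + cmean e]addrC addrK.
have -> : 4 * (1 / 16) ^+ r.+1 = 2 * (1 / 16) ^+ r.+1 + 2 * (1 / 16) ^+ r.+1 :> R by ring.
apply: cmean_bound => // t; rewrite /e !normcM !normcX normc_zT expr1n mul1r normcV.
rewrite mulrC; apply: ler_pM; rewrite ?invr_ge0 ?exprn_ge0 ?normc_ge0 //.
  rewrite -[2]invrK lef_pV2 ?posrE ?invr_gt0 //; last by rewrite normc_gt0.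
  by apply: le_trans (hq1 t); lra.
apply: lerXn2r; rewrite ?nnegrE ?normc_ge0 ?divr_ge0 //.
by rewrite !hornerE normcB -[16^-1]mul1r; exact: hq.
Qed.

End Recip.

(** * Bernstein-Szego orthogonality and the limit weight *)

Section Orthogonality.
Variables (R : realType) (X : nat -> R[i]) (mu : nat -> R).
Local Notation k2 := (ksq X mu).
Local Notation P := (Phi X mu).
Local Notation Q := (Phis X mu).
Local Notation v := (verb X mu).
Hypothesis hQ : forall n t, normc ((Q n).[zT t] - 1) <= 1 / 16.
Hypothesis hk : forall n, 1 <= k2 n <= 17 / 16.
Hypothesis hv : forall n, normc (v n) < 1.
Hypothesis hcQ : forall t, cvgn (fun n => normc (Q n).[zT t]).

(* Bernstein-Szego weight 1 / |phi_n|^2 *)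
Definition bsw n (t : R) : R := (k2 n * normc (Q n).[zT t] ^+ 2)^-1.

Lemma Phis_normc n t : 15 / 16 <= normc (Q n).[zT t] <= 17 / 16.
Proof.
have := hQ n t; have := le_normcB (Q n).[zT t] ((Q n).[zT t] - 1).
rewrite opprB addrC subrK normc1; have := le_normcD ((Q n).[zT t] - 1) 1.
by rewrite subrK normc1 => *; apply/andP; split; lra.
Qed.

Lemma bsw_den n t : 4 / 5 <= k2 n * normc (Q n).[zT t] ^+ 2 <= 5 / 4.
Proof.
have /andP[k1 k1'] := hk n; have /andP[q1 q1'] := Phis_normc n t.
have c0 : 0 <= 15 / 16 :> R by lra.
have q0 : 0 <= normc (Q n).[zT t] by lra.
have a1 := ler_pM c0 c0 q1 q1; have a2 := ler_pM q0 q0 q1' q1'.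
rewrite -expr2 in a1; rewrite -!expr2 in a2.
have k0 : 0 <= k2 n by lra.
have s0 : 0 <= normc (Q n).[zT t] ^+ 2 by rewrite exprn_ge0.
have cc : 0 <= 15 / 16 * (15 / 16) :> R by lra.
have b1 := ler_pM ler01 cc k1 a1; have b2 := ler_pM k0 s0 k1' a2.
by apply/andP; split; lra.
Qed.

Lemma bsw_bound n t : 4 / 5 <= bsw n t <= 5 / 4.
Proof.
have /andP[a b] := bsw_den n t; rewrite /bsw.
have d0 : 0 < k2 n * normc (Q n).[zT t] ^+ 2 by lra.
apply/andP; split; rewrite -[(k2 n * _)^-1]mul1r.
  by rewrite ler_pdivlMr //; lra.
by rewrite ler_pdivrMr //; lra.
Qed.

Lemma measurable_bsw n : measurable_fun setT (bsw n).
Proof.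
apply: measurable_invr.
  apply: measurable_funM; first exact: measurable_cst.
  exact: (measurable_sqr_normc (bmeas_horner (Q n))).
by move=> t; have /andP[a _] := bsw_den n t; lra.
Qed.

Lemma bmeas_bsw n : bmeas (fun t => (bsw n t)%:C).
Proof.
apply: (@bmeas_real _ _ (5 / 4)); first exact: measurable_bsw.
by move=> t; have /andP[a b] := bsw_bound n t; rewrite ger0_norm //; lra.
Qed.

Lemma bmeas_moment n l : bmeas (fun t => (P n).[zT t] * conjc (zT t ^+ l)).
Proof.
apply: bmeasM; first exact: bmeas_horner.
by apply: bmeas_conj; apply: bmeasX; exact: bmeas_zT.
Qed.

Lemma zTX_conj (t : R) l m : (l <= m)%N ->
  zT t ^+ m * conjc (zT t ^+ l) = zT t ^+ (m - l).
Proof.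
move=> h; rewrite -{1}(subnK h) exprD -mulrA rmorphXn /= -exprMn.
by rewrite normc1_conjV ?normc_zT // expr1n mulr1.
Qed.

(** On the circle [Phi_m / |Phis_m|^2 = z^m / Phis_m], which reduces the moment to the mean of
    [z^(m - l) / Phis_m]. *)
Lemma bernstein_szego m l : (l <= m)%N ->
  cmean (fun t => (bsw m t)%:C * ((P m).[zT t] * conjc (zT t ^+ l))) =
  ((k2 m)^-1)%:C * (l == m)%:R.
Proof.
move=> hl; have e t : (bsw m t)%:C * ((P m).[zT t] * conjc (zT t ^+ l)) =
    ((k2 m)^-1)%:C * (zT t ^+ (m - l) * ((Q m).[zT t])^-1).
  rewrite Phi_Phis ?normc_zT // -(zTX_conj t hl) /bsw invfM real_complexM.
  have -> : ((normc (Q m).[zT t] ^+ 2)^-1)%:C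
      = ((normc (Q m).[zT t] ^+ 2)%:C)^-1 by exact: fmorphV.
  rewrite sqr_normc_mulJ.
  have nz : (Q m).[zT t] != 0.
    by rewrite -normc_gt0; have /andP[a _] := Phis_normc m t; lra.
  have nz' : conjc (Q m).[zT t] != 0 by rewrite conjc_eq0.
  by move: ((k2 m)^-1)%:C => c; field; rewrite nz nz'.
have c15 : 0 < 15 / 16 :> R by lra.
rewrite (eq_cmean e) cmeanZ; last first.
  apply: bmeasM; first by apply: bmeasX; exact: bmeas_zT.
  by apply: (bmeas_inv c15 (bmeas_horner _)) => t; have /andP[] := Phis_normc m t.
rewrite cmean_zTX_div ?Phis_at0 //; congr (_ * (_ : bool)%:R).
by rewrite subn_eq0 eqn_leq hl.
Qed.

(** Descends from [m] to [n] by the inverse recursion [(1 - |v|^2) z Phi_n = Phi_{n+1} + conj v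
    Phis_{n+1}]. On the circle [Phis_{n+1}] is [z^(n+1)] times a conjugate, so its moment is the
    conjugate of a moment of [Phi_{n+1}]. *)
Lemma moments_bsw m n l : (n <= m)%N -> (l <= n)%N ->
  cmean (fun t => (bsw m t)%:C * ((P n).[zT t] * conjc (zT t ^+ l))) =
  ((k2 n)^-1)%:C * (l == n)%:R.
Proof.
move=> hn; move: l; have [d ed] : exists d, (n + d = m)%N by exists (m - n)%N; lia.
elim: d n ed {hn} => [|d IH] n ed l hl.
  by rewrite addn0 in ed; subst n; exact: bernstein_szego.
have {}IH := IH n.+1 _; rewrite addSnnS in IH; have {}IH := IH ed.
pose a : R := 1 - normc (v n) ^+ 2.
have a0 : 0 < a by rewrite /a subr_gt0 expr_lt1 ?normc_ge0.
have ac : a%:C != 0 :> R[i] by rewrite -normc_gt0 normc_real ger0_norm // ltW.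
apply: (mulfI ac).
pose F j t : R[i] := (bsw m t)%:C * ((P n.+1).[zT t] * conjc (zT t ^+ j)).
have bF j : bmeas (F j) by apply: bmeasM; [exact: bmeas_bsw|exact: bmeas_moment].
have e t : a%:C * ((bsw m t)%:C * ((P n).[zT t] * conjc (zT t ^+ l))) =
    F l.+1 t + conjc (v n) * conjc (F (n - l)%N t).
  have -> : conjc (F (n - l)%N t) =
      (bsw m t)%:C * ((Q n.+1).[zT t] * conjc (zT t ^+ l.+1)).
    have hl' : (l.+1 <= n.+1)%N by [].
    have e1 := zTX_conj t hl'; rewrite subSS in e1.
    rewrite /F -e1 Phi_Phis ?normc_zT //.
    have zz : conjc (zT t ^+ n.+1) * zT t ^+ n.+1 = 1.
      by rewrite -sqr_normc_mulJ normcX normc_zT !expr1n.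
    have eb : conjc (bsw m t)%:C = (bsw m t)%:C by exact: conjc_real.
    move: (bsw m t)%:C (zT t ^+ n.+1) (zT t ^+ l.+1) ((Q n.+1).[zT t]) zz eb.
    move=> c x y q zz eb; rewrite !(rmorphM conjc) /= !conjcK eb.
    transitivity (c * (q * conjc y) * (conjc x * x)); last by rewrite zz mulr1.
    ring.
  have -> : a%:C = 1 - conjc (v n) * v n.
    rewrite -sqr_normc_mulJ; apply/eqP.
    by rewrite eq_complex /= subr0 !eqxx.
  have zz : zT t * conjc (zT t) = 1 by rewrite normc1_conjV ?normc_zT.
  rewrite /F hPhiS hPhisS exprS; move: (bsw m t)%:C (zT t) zz (v n) => c z zz w.
  rewrite (rmorphM conjc) /=; move: (conjc (z ^+ l)) => y.
  transitivity ((1 - conjc w * w) * (c * ((P n).[z] * y)) * (z * conjc z)).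
    by rewrite zz mulr1.
  ring.
rewrite -cmeanZ; last by apply: bmeasM; [exact: bmeas_bsw|exact: bmeas_moment].
rewrite (eq_cmean e) cmeanD //; last first.
  by apply: bmeasM; [exact: bmeas_cst|exact: bmeas_conj].
rewrite cmeanZ; last exact: bmeas_conj.
rewrite cmean_conj // /F IH // IH ?leq_subr ?(leq_trans (leq_subr _ _)) //.
(* The conjugate moment has index [n - l], never the top one, so it vanishes. *)
have -> : (n - l == n.+1)%N = false by apply/negbTE; rewrite neq_ltn ltnS leq_subr.
rewrite mulr0 conjc0 mulr0 addr0 eqSS mulrA; congr (_ * _).
by rewrite ksqS invf_div real_complexM -/a.
Qed.

Lemma ksq_cvg : cvgn k2.
Proof.
apply: nondecreasing_is_cvgn.
  apply/nondecreasing_seqP => n; rewrite ksqS.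
  have /andP[k1 _] := hk n; have h := hv n; have h0 := normc_ge0 (v n).
  have s1 : normc (v n) ^+ 2 < 1 by rewrite expr_lt1.
  rewrite ler_pdivlMr ?subr_gt0 // ler_piMr //; first lra.
  by rewrite lerBlDr lerDl sqr_ge0.
by exists (17 / 16) => _ [n _ <-]; have /andP[] := hk n.
Qed.

Definition weight (t : R) : R := limn (bsw ^~ t).

Lemma cvg_bsw t : bsw ^~ t @ \oo --> weight t.
Proof.
suff : cvgn (bsw ^~ t) by [].
have hQ2 : cvgn (fun n => normc (Q n).[zT t] ^+ 2).
  under eq_fun do rewrite expr2; apply: is_cvgM; exact: hcQ.
have hd : cvgn (fun n => k2 n * normc (Q n).[zT t] ^+ 2).
  by apply: is_cvgM => //; exact: ksq_cvg.
apply: is_cvgV => //; rewrite gt_eqF //.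
apply: (@lt_le_trans _ _ (4 / 5)); first lra.
apply: limr_ge => //; apply: nearW => n; by have /andP[] := bsw_den n t.
Qed.

Lemma weight_bound t : 4 / 5 <= weight t <= 5 / 4.
Proof.
apply/andP; split.
  apply: limr_ge; first exact: cvg_bsw.
  by apply: nearW => n; have /andP[] := bsw_bound n t.
apply: limr_le; first exact: cvg_bsw.
by apply: nearW => n; have /andP[] := bsw_bound n t.
Qed.

Lemma measurable_weight : measurable_fun setT weight.
Proof.
apply: (measurable_fun_cvg measurable_bsw) => t _; exact: cvg_bsw.
Qed.

Lemma bmeas_weight : bmeas (fun t => (weight t)%:C).
Proof.
apply: (@bmeas_real _ _ (5 / 4)); first exact: measurable_weight.
by move=> t; have /andP[a b] := weight_bound t; rewrite ger0_norm //; lra.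
Qed.

End Orthogonality.

Lemma conjc_realM (R : realType) (r : R) (x : R[i]) :
  conjc (r%:C * x) = r%:C * conjc x.
Proof. by rewrite -{2}(conjc_real r); exact: rmorphM. Qed.

Lemma Re_realM (R : realType) (r : R) (x : R[i]) :
  complex.Re (r%:C * x) = r * complex.Re x.
Proof. by rewrite Re_mul /= mul0r subr0. Qed.

(** * The measure with a bounded density on the circle *)

Section Density.
Variable R : realType.
Local Notation mu := (@lebesgue_measure R).
Local Notation I01 := (`[0%R, 1%R[%classic : set R).
Variables (w : R -> R) (M : R).
Hypothesis mw : measurable_fun setT w.
Hypothesis w0 : forall t, 0 <= w t.
Hypothesis wM : forall t, w t <= M.

Definition density (A : set (measurableTypeR R)) : \bar R :=
  (\int[mu]_(t in A `&` I01) (w t)%:E)%E.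

Lemma integrable_w (A : set (measurableTypeR R)) : measurable A ->
  mu.-integrable (A `&` I01) (EFin \o w).
Proof.
move=> mA; have hM t : `|w t| <= M by rewrite ger0_norm.
have [h _] := bmeas_integrable (bmeas_real mw hM).
by apply: (integrableS _ _ _ h) => //; exact: measurableI.
Qed.

Lemma density0 : density set0 = 0%E.
Proof. by rewrite /density set0I integral_set0. Qed.

Lemma density_ge0 A : (0 <= density A)%E.
Proof. by apply: integral_ge0 => t _; rewrite lee_fin. Qed.

Lemma density_sigma_additive : semi_sigma_additive density.
Proof.
move=> F mF tF mUF; rewrite /density setI_bigcupl.
have tF' : trivIset setT (fun n => F n `&` I01).
  by move=> i j _ _ [t [[h1 _] [h2 _]]]; apply: tF => //; exists t.
have mF' n : measurable (F n `&` I01) by exact: measurableI.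
have iF : mu.-integrable (\bigcup_n (F n `&` I01)) (EFin \o w).
  by rewrite -setI_bigcupl; exact: integrable_w.
rewrite [X in _ --> X](integral_bigcup tF' mF' iF).
apply: is_cvg_ereal_nneg_natsum_cond => n _ _.
by apply: integral_ge0 => t _; rewrite lee_fin.
Qed.

HB.instance Definition _ := isMeasure.Build _ _ _ density
  density0 density_ge0 density_sigma_additive.

Lemma density_fin : fin_num_fun density.
Proof.
move=> A mA; rewrite /density.
exact: (integrable_fin_num (measurableI _ _ mA (measurable_itv _)) (integrable_w mA)).
Qed.

HB.instance Definition _ := Measure_isFinite.Build _ _ _ density density_fin.

Lemma density_dom : density `<< mu.
Proof.
apply/null_content_dominatesP => A mA A0; rewrite /density.
apply: null_set_integral => //.
- exact: measurableI.
- by apply/measurable_EFinP; exact: measurable_funTS.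
- by apply: (subset_measure0 _ _ _ A0) => //; exact: measurableI.
Qed.

(** The Radon-Nikodym derivative of [density] agrees almost everywhere on [[0, 1)] with [w], both
    having the same integral over each measurable subset; the change of variables then applies. *)
Lemma integral_density (f : R -> R) (K : R) : measurable_fun setT f ->
  (forall t, `|f t| <= K) ->
  (\int[density]_(t in I01) (f t)%:E = \int[mu]_(t in I01) (f t * w t)%:E)%E.
Proof.
move=> mf fK; have mI : measurable (I01 : set (measurableTypeR R)) by [].
have intf : (density : {measure set _ -> \bar R}).-integrable I01 (EFin \o f).
  apply: measurable_bounded_integrable => //.
  - by rewrite ltey_eq density_fin.
  - exact: measurable_funTS.
  - exists K; split; rewrite ?num_real // => x Kx y _ /=.
    by apply: le_trans (ltW Kx).
rewrite -(Radon_Nikodym_change_of_variables density_dom mI intf).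
apply: ae_eq_integral => //.
- apply: emeasurable_funM; first exact: (measurable_int _ intf).
  apply: (measurable_int mu); apply: (integrableS _ _ (@subsetT _ _)) => //.
  by apply: Radon_Nikodym_integrable; exact: density_dom.
- by apply/measurable_EFinP; apply: measurable_funTS; exact: measurable_funM.
rewrite (_ : (fun t => (f t * w t)%:E) = (fun t => (EFin \o f) t * (EFin \o w) t)%E) //.
apply: ae_eqe_mul2l.
rewrite Radon_NikodymE; first exact: density_dom.
move=> dm; case: cid => h [h1 h2 h3] /=.
apply: integral_ae_eq => //.
- exact: integrableS h2.
- by apply/measurable_EFinP; exact: measurable_funTS.
move=> A AI mA; rewrite -h3 //= /density.
by rewrite (setIidl AI).
Qed.

Lemma density_measure_exists :
  exists sigma : {measure set (measurableTypeR R) -> \bar R},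
  (forall A, sigma A = (\int[mu]_(t in A `&` I01) (w t)%:E)%E) /\
  (forall (f : R -> R) (K : R), measurable_fun setT f -> (forall t, `|f t| <= K) ->
   (\int[sigma]_(t in I01) (f t)%:E = \int[mu]_(t in I01) (f t * w t)%:E)%E).
Proof. by exists density; split=> [A //|f K mf fK]; exact: (integral_density mf fK). Qed.

End Density.

(** * Orthonormality and the Szego class for the limit weight *)

Section OrthonormalPolynomials.
Variables (R : realType) (X : nat -> R[i]) (mv : nat -> R).
Local Notation mu := (@lebesgue_measure R).
Local Notation I01 := (`[0%R, 1%R[%classic : set R).
Local Notation k2 := (ksq X mv).
Local Notation P := (Phi X mv).
Local Notation Q := (Phis X mv).
Local Notation v := (verb X mv).
Hypothesis hQ : forall n t, normc ((Q n).[zT t] - 1) <= 1 / 16.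
Hypothesis hk : forall n, 1 <= k2 n <= 17 / 16.
Hypothesis hv : forall n, normc (v n) < 1.
Hypothesis hcQ : forall t, cvgn (fun n => normc (Q n).[zT t]).
Local Notation W := (weight X mv).
Local Notation bw := (bsw X mv).

Lemma weight_bd t : 4 / 5 <= W t <= 5 / 4.
Proof. exact: weight_bound. Qed.

(** Dominated convergence with a constant dominating function; the integrals are constant from index
    [n] on. *)
Lemma mean_limit (g : R -> R) (K r : R) n : measurable_fun setT g ->
  (forall t, `|g t| <= K) ->
  (forall m, (n <= m)%N -> \int[mu]_(t in I01) (bw m t * g t) = r) ->
  \int[mu]_(t in I01) (W t * g t) = r.
Proof.
move=> mg gK hr.
have K0 : 0 <= K by apply: le_trans (gK 0).
have bd m t : `|bw m t * g t| <= 5 / 4 * K.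
  rewrite normrM; apply: ler_pM => //; have /andP[a b] := bsw_bound hQ hk m t.
  by rewrite ger0_norm //; lra.
have mm m : measurable_fun setT (fun t => bw m t * g t).
  by apply: measurable_funM => //; exact: measurable_bsw.
have [ic _] := bmeas_integrable (bmeas_cst (5 / 4 * K)%:C).
have im m : mu.-integrable I01 (fun t => (bw m t * g t)%:E).
  by have [] := bmeas_integrable (bmeas_real (mm m) (bd m)).
have lim : (\int[mu]_(t in I01) (bw m t * g t)%:E @[m --> \oo] -->
    \int[mu]_(t in I01) (W t * g t)%:E)%E.
  apply: (@dominated_cvg _ _ _ mu I01 _ (fun m t => (bw m t * g t)%:E)
    (fun t => (W t * g t)%:E) (fun=> (5 / 4 * K)%:E)) => //.
  - by move=> m; apply/measurable_EFinP; exact: (measurable_funTS (mm m)).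
  - move=> t _; have h : bw m t * g t @[m --> \oo] --> W t * g t.
      by apply: cvgMl; exact: (cvg_bsw hQ hk hv hcQ).
    by apply: (cvg_comp _ _ h).
  - by move=> m t _; rewrite lee_fin; exact: bd.
have lim2 : (\int[mu]_(t in I01) (bw m t * g t)%:E @[m --> \oo] --> r%:E)%E.
  apply: cvg_near_cst; exists n => // m /= hm.
  by rewrite -(hr m hm) /Rintegral fineK //; exact: integrable_fin_num.
by rewrite /Rintegral (cvg_unique _ lim lim2).
Qed.

Lemma cmean_limit (f : R -> R[i]) (c : R[i]) n : bmeas f ->
  (forall m, (n <= m)%N -> cmean (fun t => (bw m t)%:C * f t) = c) ->
  cmean (fun t => (W t)%:C * f t) = c.
Proof.
move=> [m1 m2 [K hK]] h; apply/eqP; rewrite eq_complex; apply/andP; split; apply/eqP.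
- transitivity (\int[mu]_(t in I01) (W t * complex.Re (f t))).
    by apply: eq_Rintegral => t _; rewrite Re_realM.
  apply: (mean_limit (n := n) m1).
    by move=> t; apply: le_trans (hK t); exact: normc_ge_absRe.
  move=> m hm; rewrite -(h m hm) /=.
  by apply: eq_Rintegral => t _; rewrite Re_realM.
- transitivity (\int[mu]_(t in I01) (W t * complex.Im (f t))).
    by apply: eq_Rintegral => t _; rewrite Im_realM.
  apply: (mean_limit (n := n) m2).
    by move=> t; apply: le_trans (hK t); exact: normc_ge_absIm.
  move=> m hm; rewrite -(h m hm) /=.
  by apply: eq_Rintegral => t _; rewrite Im_realM.
Qed.

Lemma moments n l : (l <= n)%N ->
  cmean (fun t => (W t)%:C * ((P n).[zT t] * conjc (zT t ^+ l))) =
  ((k2 n)^-1)%:C * (l == n)%:R.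
Proof.
move=> hl; apply: (@cmean_limit _ _ n (bmeas_moment X mv n l)) => m hm.
exact: moments_bsw.
Qed.

Lemma bmeas_W : bmeas (fun t => (W t)%:C).
Proof. exact: bmeas_weight. Qed.

(** Expanding [Phi_k] in powers of [z], only the power [n] has a nonzero moment; it occurs for
    [k = n] alone, with coefficient 1. *)
Lemma ortho_le n k : (k <= n)%N ->
  cmean (fun t => (W t)%:C * ((P n).[zT t] * conjc (P k).[zT t])) =
  ((k2 n)^-1)%:C * (k == n)%:R.
Proof.
move=> hkn; have [sP mP _] := size_Phi_Phis X mv k.
pose F l t : R[i] := conjc (P k)`_l * ((W t)%:C * ((P n).[zT t] * conjc (zT t ^+ l))).
have bF l : bmeas (F l).
  by apply: bmeasM; [exact: bmeas_cst|apply: bmeasM; [exact: bmeas_W|exact: bmeas_moment]].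
rewrite (eq_cmean (g := fun t => \sum_(l < k.+1) F l t)); last first.
  move=> t; rewrite [(P k).[_]]horner_coef sP (rmorph_sum conjc) !mulr_sumr.
  by apply: eq_bigr => l _; rewrite /F (rmorphM conjc) /=; ring.
rewrite cmean_sum //.
have eF l : (l <= k)%N -> cmean (F l) =
    conjc (P k)`_l * (((k2 n)^-1)%:C * (l == n)%:R).
  move=> hl; rewrite /F cmeanZ; last first.
    by apply: bmeasM; [exact: bmeas_W|exact: bmeas_moment].
  by rewrite moments // (leq_trans hl).
rewrite big_ord_recr /= big1 => [|l _]; last first.
  rewrite eF ?(ltnW (ltn_ord l)) //.
  by rewrite ltn_eqF ?mulr0 // (leq_trans (ltn_ord l)).
rewrite add0r eF //.
have -> : (P k)`_k = 1.
  by move: mP; rewrite monicE /lead_coef sP => /eqP.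
by rewrite conjc1 mul1r.
Qed.

Definition ophi n : {poly R[i]} := (Num.sqrt (k2 n))%:C *: P n.

Lemma ortho n k :
  cmean (fun t => (W t)%:C * ((ophi n).[zT t] * conjc (ophi k).[zT t])) =
  (if n == k then 1 else 0).
Proof.
have s_ge0 i : 0 <= k2 i by have /andP[a _] := hk i; lra.
have e t : (W t)%:C * ((ophi n).[zT t] * conjc (ophi k).[zT t]) =
   (Num.sqrt (k2 n) * Num.sqrt (k2 k))%:C *
   ((W t)%:C * ((P n).[zT t] * conjc (P k).[zT t])).
  by rewrite /ophi !hornerZ conjc_realM real_complexM; ring.
have b : bmeas (fun t => (W t)%:C * ((P n).[zT t] * conjc (P k).[zT t])).
  apply: bmeasM; first exact: bmeas_W.
  by apply: bmeasM; [|apply: bmeas_conj]; exact: bmeas_horner.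
rewrite (eq_cmean e) cmeanZ //.
case: (ltngtP n k) => [h|h|<-].
(* The weight is real, so conjugation exchanges the two polynomials. *)
- rewrite (eq_cmean (g := fun t => conjc ((W t)%:C * ((P k).[zT t] * conjc (P n).[zT t])))).
    rewrite cmean_conj; last first.
      apply: bmeasM; first exact: bmeas_W.
      by apply: bmeasM; [|apply: bmeas_conj]; exact: bmeas_horner.
    by rewrite ortho_le ?(ltnW h) // ltn_eqF // mulr0 conjc0 mulr0.
  move=> t; have eb : conjc (W t)%:C = (W t)%:C by exact: conjc_real.
  move: (W t)%:C eb (P k).[zT t] (P n).[zT t] => c eb p q.
  by rewrite !(rmorphM conjc) /= conjcK eb; ring.
- by rewrite ortho_le ?(ltnW h) // ltn_eqF // !mulr0.
- rewrite ortho_le // eqxx mulr1 -real_complexM -expr2 sqr_sqrtr // divff //.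
  by have /andP[a _] := hk n; lra.
Qed.

Lemma opuc_exists :
  exists sigma : {measure set (measurableTypeR R) -> \bar R},
  [/\ circle_prob sigma, infinite_support sigma, szego_class sigma &
      orthonormal_polys sigma ophi].
Proof.
have W0 t : 0 <= W t by have /andP[a _] := weight_bd t; lra.
have WM t : W t <= 5 / 4 by have /andP[] := weight_bd t.
have mW : measurable_fun setT W by exact: measurable_weight.
have [sigma [sE sI]] := density_measure_exists mW W0 WM.
have mI : measurable (I01 : set (measurableTypeR R)) by [].
have mu01 : mu I01 = 1%E.
  by rewrite lebesgue_measure_itv /= lte_fin ltr01 oppr0 adde0.
exists sigma; split.
- split; rewrite sE; last by rewrite setICl integral_set0.
  (* [phi_0 = 1], so its norm is the total mass. *)
  rewrite setIid; have := ortho 0 0; rewrite eqxx => /(congr1 (@complex.Re R)) /= h.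
  have -> : (1 = (1 : R)%:E)%E by [].
  rewrite -[in RHS]h /Rintegral fineK; last first.
    apply: integrable_fin_num => //.
    have [] // := @bmeas_integrable _ (fun t => (W t)%:C * ((ophi 0).[zT t] * conjc (ophi 0).[zT t])) _.
    apply: bmeasM; first exact: bmeas_W.
    by apply: bmeasM; [|apply: bmeas_conj]; exact: bmeas_horner.
  apply: eq_integral => t _; congr (_%:E).
  have -> : (ophi 0).[zT t] = 1 by rewrite /ophi hornerZ ksq0 sqrtr1 hornerC mulr1.
  by rewrite conjc1 !mulr1.
(* The weight is at least 4/5, and intervals of radius at most 1/4 about these points stay inside
   [[0, 1)]. *)
- have sub : `[(1/4 : R), 1/2] `<=` supp sigma.
    move=> t /=; rewrite in_itv /= => /andP[t1 t2] e e0.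
    have [d d0 [de d4]] : exists2 d : R, 0 < d & d <= e /\ d <= 1 / 4.
      exists (Num.min e (1 / 4)); first by rewrite lt_min e0; lra.
      by rewrite !ge_min !lexx orbT.
    pose B : set R := `]t - d, t + d[%classic.
    have mB : measurable (B : set (measurableTypeR R)) by exact: measurable_itv.
    have subI : B `<=` ball t e `&` I01.
      move=> x; rewrite /B /= in_itv /= => /andP[x1 x2]; split.
        by rewrite /ball /= ltr_norml; apply/andP; split; lra.
      by rewrite /= in_itv /=; apply/andP; split; lra.
    rewrite sE; apply: (@lt_le_trans _ _ (\int[mu]_(x in B) (4 / 5)%:E)%E).
      rewrite integral_cst //= /B lebesgue_measure_itv /= lte_fin.
      rewrite ifT; last lra.
      by rewrite -EFinB -EFinM lte_fin; lra.
    apply: (@le_trans _ _ (\int[mu]_(x in B) (W x)%:E)%E).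
      apply: ge0_le_integral.
      + exact: mB.
      + by move=> x _; rewrite lee_fin; lra.
      + exact: measurable_cst.
      + by apply/measurable_EFinP; exact: measurable_funTS.
      + by move=> x _; rewrite lee_fin; have /andP[] := weight_bd x.
    apply: ge0_subset_integral.
    + exact: mB.
    + by apply: measurableI => //; exact: measurable_ball.
    + by apply/measurable_EFinP; exact: measurable_funTS.
    + by move=> x _; rewrite lee_fin.
    + exact: subI.
  move=> /(sub_finite_set sub)/finite_set_countable/countable_lebesgue_measure0.
  rewrite lebesgue_measure_itv /= lte_fin ifT; last lra.
  by rewrite -EFinB => -[]; lra.
- exists W, mzero, set0; split; [exact: W0|exact: mW| | |].
  + by split; [exact: measurable0|split; [exact: measure0|]].
  + by move=> A _; rewrite sE; symmetry; exact: adde0.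
  have lnW t : elog (W t) = (ln (W t))%:E.
    by rewrite /elog ifF //; have /andP[a _] := weight_bd t; rewrite gt_eqF //; lra.
  under eq_integral do rewrite lnW.
  have mln : measurable_fun setT (fun t => ln (W t)).
    exact: (measurableT_comp (@measurable_ln R)).
  have bln t : `|ln (W t)| <= `|ln (4 / 5)| + `|ln (5 / 4 : R)|.
    have /andP[a b] := weight_bd t.
    have h1 : ln (4 / 5) <= ln (W t) by rewrite ler_ln ?posrE; lra.
    have h2 : ln (W t) <= ln (5 / 4) by rewrite ler_ln ?posrE; lra.
    have := ler_norm (ln (5 / 4 : R)); have := ler_norm (- ln (4 / 5 : R)).
    rewrite normrN ler_norml => n1 n2.
    have := normr_ge0 (ln (5 / 4 : R)); have := normr_ge0 (ln (4 / 5 : R)).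
    by move=> n3 n4; apply/andP; split; lra.
  have [il _] := bmeas_integrable (bmeas_real mln bln).
  by rewrite ltNye_eq (integrable_fin_num mI il).
split; [|split].
- move=> n; have [sP _ _] := size_Phi_Phis X mv n.
  rewrite /ophi size_scale // -normc_gt0 normc_real normr_gt0 gt_eqF // sqrtr_gt0.
  by have /andP[a _] := hk n; lra.
- move=> n; have [_ mP _] := size_Phi_Phis X mv n.
  rewrite /ophi lead_coefZ (monicP mP) mulr1 ltcR sqrtr_gt0.
  by have /andP[a _] := hk n; lra.
move=> n k.
have bnk : bmeas (fun t => (ophi n).[zT t] * conjc (ophi k).[zT t]).
  by apply: bmeasM; [|apply: bmeas_conj]; exact: bmeas_horner.
have [m1 m2 [K hK]] := bnk.
have [i1 i2] := bmeas_integrable (bmeasM bmeas_W bnk).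
have onk := ortho n k.
split.
- rewrite (sI _ K) //; last first.
    by move=> t; apply: le_trans (hK t); exact: normc_ge_absRe.
  rewrite -onk /cmean /Rintegral /= fineK; last exact: (integrable_fin_num mI i1).
  by apply: eq_integral => t _; rewrite Re_realM mulrC.
- rewrite (sI _ K) //; last first.
    by move=> t; apply: le_trans (hK t); exact: normc_ge_absIm.
  rewrite -onk /cmean /Rintegral /= fineK; last exact: (integrable_fin_num mI i2).
  by apply: eq_integral => t _; rewrite Im_realM mulrC.
Qed.

End OrthonormalPolynomials.

(** * Choice of the superblocks and the divergence *)

Section Construction.
Variable R : realType.

(** A harmonic sum starting at 1/2: a centre in slot [d = i + 1] is at most [(d + 1) / J] away,
    which yields the term [1 / (i + 2)]. *)
Definition Lam m : R := \sum_(i < m) i.+2%:R^-1.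

(* The numerals 4096 and 65536 are kept abstract: unary numerals of that size
   make conversion explode. *)
Variables c0 c1 : R.
Hypothesis c0E : c0 = 64 * 64.
Hypothesis c1E : c1 = 16 * c0.

Lemma c0_gt0 : 0 < c0. Proof. by rewrite c0E; lra. Qed.

Lemma c1_gt0 : 0 < c1. Proof. by have := c0_gt0; rewrite c1E; lra. Qed.

(** The product [mu L] for each block of superblock [s], hence the order of its increment at the
    centre; summable over [s], with [c0] making the total small. *)
Definition eps s : R := (c0 * 2 ^+ s)^-1.

Lemma LamE m : hsum R m.+1 = 1 + Lam m.
Proof.
rewrite /hsum big_nat_recl // invr1; congr (_ + _).
by rewrite /Lam big_mkord.
Qed.

Lemma pow2_gt0 s : 0 < 2 ^+ s :> R.
Proof. by rewrite exprn_gt0. Qed.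

Lemma pow2_ge1 s : 1 <= 2 ^+ s :> R.
Proof. by rewrite exprn_ege1 // ler1n. Qed.

Lemma eps_gt0 s : 0 < eps s.
Proof. by rewrite invr_gt0 mulr_gt0 ?c0_gt0 ?pow2_gt0. Qed.

Lemma epsE s : eps s = c0^-1 / 2 ^+ s.
Proof. by rewrite /eps invfM. Qed.

Lemma eps_le_c0 s : eps s <= c0^-1.
Proof.
rewrite epsE ler_pdivrMr ?pow2_gt0 // ler_peMr ?pow2_ge1 //.
by rewrite invr_ge0 ltW ?c0_gt0.
Qed.

Lemma c0V : c0 * c0^-1 = 1.
Proof. by rewrite divff // gt_eqF // c0_gt0. Qed.

Lemma eps_le s : eps s <= 1 / 64.
Proof.
apply: (le_trans (eps_le_c0 s)); have := c0V.
have : 0 < c0^-1 by rewrite invr_gt0 c0_gt0.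
by rewrite {2}c0E; lra.
Qed.

(** [p.1] is the number of gaining blocks and [p.2] the ratio [L / J]. The ratio must dominate the
    harmonic sum over all centres, to keep [Phis] near 1, yet stay comparable to [Lam], to keep the
    coefficients in l^2. *)
Lemma superblock_size s : exists p : nat * nat,
  [/\ (0 < p.1)%N, hsum R (8 * p.1) <= p.2%:R, p.2%:R <= 2 * Lam p.1 &
      c1 * 2 ^+ s / eps s ^+ 2 <= Lam p.1].
Proof.
(* The summand 20 absorbs the additive losses of [hsum_mul8], [LamE] and the rounding in
   [p.2 <= 2 Lam]. *)
pose A : R := c1 * 2 ^+ s / eps s ^+ 2 + 20.
have [m hm] := hsum_unbounded A.
have A0 : 20 <= A by rewrite /A lerDr divr_ge0 ?mulr_ge0 ?exprn_ge0 // ltW ?c1_gt0 ?eps_gt0.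
have hm1 : A <= 1 + Lam m by rewrite -LamE (le_trans hm) // hsum_mono.
case: m hm hm1 => [|m] hm hm1.
  by move: hm; rewrite /hsum big_geq //; lra.
exists (m.+1, (Num.truncn (hsum R (8 * m.+1))).+1); split=> //=.
- by apply: ltW; apply: truncnS_gt.
- have h8 := hsum_mul8 R m; have h0 := hsum_ge0 R (8 * m.+1).
  have := truncn_le (hsum R (8 * m.+1)); rewrite h0 => tr.
  have mm : hsum R m <= 1 + Lam m.+1 by rewrite -LamE hsum_mono // leqW.
  rewrite -natr1; move: tr; set T := (Num.truncn _)%:R; lra.
- by move: hm1; rewrite /A; set B := _ / _; lra.
Qed.

Variables m K : nat -> nat.
Hypothesis m_gt0 : forall s, (0 < m s)%N.
Hypothesis hK : forall s, hsum R (8 * m s) <= (K s)%:R.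
Hypothesis K_le : forall s, (K s)%:R <= 2 * Lam (m s).
Hypothesis Lam_ge : forall s, c1 * 2 ^+ s / eps s ^+ 2 <= Lam (m s).

(** With [8 m] centres, the [m] slots used on one side of a point stay within a quarter turn, as
    [Im_inv_1BzT] requires. *)
Definition Js s := (8 * m s)%N.
Definition Ls s := (Js s * K s)%N.
(** Two turns through the centres, so that for every point the [m] centres behind it occur as
    consecutive blocks. *)
Definition slen s := (2 * Js s)%N.
Definition Lb b := Ls (locate slen b).1.
Definition tbb b : R := let p := locate slen b in (p.2 %% Js p.1)%:R / (Js p.1)%:R.
Definition mbb b : R := let s := (locate slen b).1 in eps s / (Ls s)%:R.
(** Scaled so that half of the main term of a superblock, [lam * eps * J * Lam / 64], is exactly
    1. *)
Definition lbb b : R := let s := (locate slen b).1 in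
  64 / ((Js s)%:R * eps s * Lam (m s)).
Definition Vb b t : R := let p := locate slen b in
  vbound (Ls p.1) (Js p.1) (p.2 %% Js p.1) t.

Lemma Js_gt0 s : (0 < Js s)%N. Proof. by rewrite muln_gt0 m_gt0. Qed.

Lemma K_ge1 s : 1 <= (K s)%:R :> R.
Proof.
apply: le_trans (hK s); have h : hsum R 1 <= hsum R (8 * m s).
  by apply: hsum_mono; exact: Js_gt0.
by apply: le_trans h; rewrite /hsum big_nat1 invr1.
Qed.

Lemma K_gt0 s : (0 < K s)%N.
Proof. by have := K_ge1 s; rewrite ler1n. Qed.

Lemma LsE s : (Ls s)%:R = (Js s)%:R * (K s)%:R :> R.
Proof. exact: natrM. Qed.

Lemma Kr_gt0 s : 0 < (K s)%:R :> R.
Proof. by rewrite ltr0n K_gt0. Qed.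

Lemma Ls_gt0 s : (0 < Ls s)%N. Proof. by rewrite muln_gt0 Js_gt0 K_gt0. Qed.
Lemma slen_gt0 s : (0 < slen s)%N. Proof. by rewrite muln_gt0 Js_gt0. Qed.

Lemma Lam_gt0 s : 0 < Lam (m s).
Proof.
apply: lt_le_trans (Lam_ge s).
by rewrite divr_gt0 ?mulr_gt0 ?exprn_gt0 ?c1_gt0 ?pow2_gt0 ?eps_gt0.
Qed.

Lemma Lb_gt0 b : (0 < Lb b)%N. Proof. exact: Ls_gt0. Qed.

Lemma mbb_ge0 b : 0 <= mbb b.
Proof. by rewrite divr_ge0 // ltW // eps_gt0. Qed.

Lemma lbb_ge0 b : 0 <= lbb b.
Proof.
by rewrite divr_ge0 // !mulr_ge0 // ltW ?eps_gt0 ?Lam_gt0.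
Qed.

Lemma Vb_ge0 b t : 0 <= Vb b t.
Proof. exact: vbound_ge0. Qed.

Lemma Vb_cover b t :
  2 * (Lb b)%:R <= Vb b t \/ 5 <= Vb b t * normc (1 - zT (t - tbb b)).
Proof. by apply: vbound_cover; rewrite ?ltn_mod Js_gt0. Qed.

Local Notation ss := (start slen).

Lemma sum_super (f : nat -> nat -> R) s :
  \sum_(ss s <= b < ss s.+1) f (locate slen b).1 (locate slen b).2 =
  \sum_(0 <= j < 2 * Js s) f s j.
Proof.
rewrite sum_block big_mkord; apply: eq_bigr => j _.
by rewrite (locate_start slen_gt0).
Qed.

(** Since [hK] gives [J * hsum J <= L], the bound of [sum_vbound] is at most [40 L], and the factor
    [mu = eps / L] leaves [40 eps]. *)
Lemma group_V t s : \sum_(ss s <= b < ss s.+1) mbb b * Vb b t <= 40 / c0 / 2 ^+ s.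
Proof.
rewrite (sum_super (fun s j => eps s / (Ls s)%:R *
   vbound (Ls s) (Js s) (j %% Js s) t)) -mulr_sumr.
have L0 : 0 < (Ls s)%:R :> R by rewrite ltr0n Ls_gt0.
have e0 := eps_gt0 s.
apply: (@le_trans _ _ (eps s / (Ls s)%:R * (20 * ((Ls s)%:R + (Js s)%:R * hsum R (Js s))))).
  rewrite ler_wpM2l ?divr_ge0 ?(ltW e0) ?(ltW L0) //.
  by apply: sum_vbound; exact: Js_gt0.
apply: (@le_trans _ _ (eps s / (Ls s)%:R * (40 * (Ls s)%:R))).
  rewrite ler_wpM2l ?divr_ge0 ?(ltW e0) ?(ltW L0) //.
  have : (Js s)%:R * hsum R (Js s) <= (Ls s)%:R.
    by rewrite LsE ler_wpM2l // hK.
  lra.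
by rewrite mulrCA divfK ?gt_eqF // epsE !mulrA.
Qed.

Lemma mbbVb_ge0 t b : 0 <= mbb b * Vb b t.
Proof. by rewrite mulr_ge0 ?mbb_ge0 ?Vb_ge0. Qed.

Lemma tail_V t s n : \sum_(ss s <= b < n) mbb b * Vb b t <= 2 * (40 / c0) / 2 ^+ s.
Proof. exact: (geometric_tail slen_gt0 (mbbVb_ge0 t) (group_V t)). Qed.

Lemma sum_V' B t : \sum_(0 <= b < B) mbb b * Vb b t <= 1 / 16.
Proof.
have := tail_V t 0 B; rewrite start0 expr0 divr1 => /le_trans; apply.
by rewrite mulrA ler_pdivrMr ?c0_gt0 // c0E; lra.
Qed.

Lemma tail_V_small t e : 0 < e ->
  exists B, forall n, \sum_(B <= b < n) mbb b * Vb b t <= e.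
Proof.
move=> e0; pose s := Num.truncn e^-1; exists (ss s) => n.
apply: (le_trans (tail_V t s n)).
have h1 : e^-1 < s.+1%:R by apply: truncnS_gt.
have h2 : s.+1%:R <= 2 ^+ s :> R by rewrite -natrX ler_nat ltn_expl.
have p0 := pow2_gt0 s; rewrite ler_pdivrMr //.
have cc : 2 * (40 / c0) <= 1 by rewrite mulrA ler_pdivrMr ?c0_gt0 // c0E; lra.
have : e * e^-1 = 1 by rewrite divff ?gt_eqF.
have : e * e^-1 < e * 2 ^+ s by rewrite ltr_pM2l // (lt_le_trans h1).
lra.
Qed.

Lemma sum_mbb2 B : \sum_(0 <= b < B) mbb b ^+ 2 * (Lb b)%:R <= 1 / 64.
Proof.
have g s : \sum_(ss s <= b < ss s.+1) mbb b ^+ 2 * (Lb b)%:R <= 1 / 128 / 2 ^+ s.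
  rewrite (sum_super (fun s j => (eps s / (Ls s)%:R) ^+ 2 * (Ls s)%:R)).
  rewrite sumr_const_nat subn0 -[_ *+ (2 * _)]mulr_natl.
  have J0 : 0 < (Js s)%:R :> R by rewrite ltr0n Js_gt0.
  have K1 := K_ge1 s.
  have -> : (2 * Js s)%:R * ((eps s / (Ls s)%:R) ^+ 2 * (Ls s)%:R) =
      2 * (eps s ^+ 2 * (K s)%:R^-1).
    by rewrite LsE (natrM _ 2); field; rewrite !gt_eqF ?Kr_gt0.
  have e0 := eps_gt0 s; have e1 := eps_le s.
  apply: (@le_trans _ _ (2 * (eps s ^+ 2 * 1))).
    by rewrite ler_wpM2l // ler_wpM2l ?exprn_ge0 ?(ltW e0) // invf_le1 //; lra.
  have h1 : eps s ^+ 2 <= 1 / 64 * eps s by rewrite expr2 ler_wpM2r // ltW.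
  have h2 : eps s <= 1 / 64 / 2 ^+ s.
    rewrite epsE ler_wpM2r ?invr_ge0 ?(ltW (pow2_gt0 s)) //.
    by have := eps_le 0; rewrite epsE expr0 divr1.
  have -> : 1 / 128 / 2 ^+ s = 1 / 2 * (1 / 64 / 2 ^+ s) :> R.
    by field; rewrite gt_eqF ?pow2_gt0.
  move: h1 h2 e0; rewrite mulr1; move: (1 / 64 / _) (eps s ^+ 2) => x y; lra.
have f0 b : 0 <= mbb b ^+ 2 * (Lb b)%:R by rewrite mulr_ge0 ?sqr_ge0.
have := geometric_tail slen_gt0 f0 g 0 B.
by rewrite start0 expr0 divr1 => /le_trans; apply; lra.
Qed.

(** A superblock contributes [6 c0 K / (eps^2 Lam^2)], at most [12 c0 / (eps^2 Lam)] by [K_le];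
    [Lam_ge] with [c1 = 16 c0] brings this below [1 / 2^s]. *)
Lemma sum_lbb2 B : \sum_(0 <= b < B) (3 * (Lb b)%:R) * lbb b ^+ 2 <= 2.
Proof.
have g s : \sum_(ss s <= b < ss s.+1) (3 * (Lb b)%:R) * lbb b ^+ 2 <= 1 / 2 ^+ s.
  rewrite (sum_super (fun s j => 3 * (Ls s)%:R *
    (64 / ((Js s)%:R * eps s * Lam (m s))) ^+ 2)).
  rewrite sumr_const_nat subn0 -[_ *+ (2 * _)]mulr_natl.
  have J0 : 0 < (Js s)%:R :> R by rewrite ltr0n Js_gt0.
  have e0 := eps_gt0 s; have l0 := Lam_gt0 s; have p0 := pow2_gt0 s.
  have -> : (2 * Js s)%:R * (3 * (Ls s)%:R * (64 / ((Js s)%:R * eps s * Lam (m s))) ^+ 2)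
     = 6 * c0 * (K s)%:R / (eps s ^+ 2 * Lam (m s) ^+ 2).
    by rewrite LsE (natrM _ 2) c0E; field; rewrite !gt_eqF.
  have el0 : 0 < eps s ^+ 2 * Lam (m s) ^+ 2 by rewrite mulr_gt0 ?exprn_gt0.
  rewrite ler_pdivrMr // [1 / _ * _]mulrAC ler_pdivlMr //.
  have e20 : 0 < eps s ^+ 2 by rewrite exprn_gt0.
  have hl : c1 * 2 ^+ s <= Lam (m s) * eps s ^+ 2 by rewrite -ler_pdivrMr // Lam_ge.
  apply: (@le_trans _ _ (6 * c0 * (2 * Lam (m s)) * 2 ^+ s)).
    by rewrite ler_wpM2r ?(ltW p0) // ler_wpM2l ?K_le // mulr_ge0 // ltW ?c0_gt0.
  have : Lam (m s) * (c1 * 2 ^+ s) <= Lam (m s) * (Lam (m s) * eps s ^+ 2).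
    by rewrite ler_wpM2l // ltW.
  have : 0 <= Lam (m s) * 2 ^+ s by rewrite mulr_ge0 // ltW.
  have -> : 6 * c0 * (2 * Lam (m s)) * 2 ^+ s = 12 * c0 * (Lam (m s) * 2 ^+ s) by ring.
  have -> : Lam (m s) * (c1 * 2 ^+ s) = 16 * c0 * (Lam (m s) * 2 ^+ s) by rewrite c1E; ring.
  have -> : 1 * (eps s ^+ 2 * Lam (m s) ^+ 2) = Lam (m s) * (Lam (m s) * eps s ^+ 2) by ring.
  move: (Lam (m s) * 2 ^+ s) (Lam _ * (_ * _)) => x y x0 h.
  have : 0 <= c0 * x by rewrite mulr_ge0 // ltW ?c0_gt0.
  by move: h; rewrite -!mulrA; lra.
have f0 b : 0 <= (3 * (Lb b)%:R) * lbb b ^+ 2 by rewrite mulr_ge0 ?sqr_ge0 // mulr_ge0.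
have := geometric_tail slen_gt0 f0 g 0 B.
by rewrite start0 expr0 divr1 mulr1.
Qed.

Local Notation X := (bpoint Lb tbb).
Local Notation mv := (bmu Lb mbb).
Local Notation lv := (blam Lb lbb).
Local Notation kn := (kern X mv).
Local Notation st := (start (blen Lb)).

Lemma zT_slot (t : R) s d (i0 := Num.truncn (t * (Js s)%:R)) :
  0 <= t < 1 -> (0 < d <= m s)%N ->
  let b := (ss s + (Js s + i0 - d))%N in
  exists2 c : R, d%:R / (Js s)%:R <= c <= d.+1%:R / (Js s)%:R &
   zT (t - tbb b) = zT c /\ (locate slen b).1 = s.
Proof.
move=> /andP[t0 t1] /andP[d0 dm] b.
have Jr : 0 < (Js s)%:R :> R by rewrite ltr0n Js_gt0.
have tJ : 0 <= t * (Js s)%:R by rewrite mulr_ge0 // ltW.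
have /andP[i1 i2] := truncn_itv tJ; rewrite -/i0 in i1 i2.
have iJ : (i0 < Js s)%N by rewrite -(ltr_nat R) (le_lt_trans i1) // gtr_pMl.
have mJ : (m s <= Js s)%N by rewrite leq_pmull.
set j := (Js s + i0 - d)%N in b *.
have jl : (j < slen s)%N by rewrite /slen /j; lia.
have eb : locate slen b = (s, j) by rewrite (locate_start slen_gt0).
exists ((t * (Js s)%:R - i0%:R + d%:R) / (Js s)%:R).
  by rewrite !ler_pM2r ?invr_gt0 // -[d.+1%:R]natr1 -[i0.+1%:R]natr1 in i2 *; apply/andP; split; lra.
rewrite eb; split=> //; rewrite /tbb eb /=.
(* Both angles are shifted by whole turns: one undoes the reduction modulo [J], the other accounts
   for starting in the second turn. *)
rewrite -(zTBn (t - _) (j %/ Js s)) -[RHS](zTBn _ 1); congr zT.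
have ej : j%:R = (j %/ Js s)%:R * (Js s)%:R + (j %% Js s)%:R :> R.
  by rewrite -natrM -natrD -divn_eq.
have ej' : j%:R = (Js s)%:R + i0%:R - d%:R :> R.
  by rewrite /j natrB ?natrD //; lia.
have -> : (j %% Js s)%:R = (Js s)%:R + i0%:R - d%:R - (j %/ Js s)%:R * (Js s)%:R :> R.
  by rewrite -ej' ej; ring.
by field; rewrite gt_eqF.
Qed.

(** The blocks whose centres lie [m, ..., 1] slots behind the point are consecutive and gain with
    the same sign. Their main terms, of order [1 / d], add up to a multiple of [Lam]; their errors,
    of order [1 / d^2], stay bounded relative to [J]. *)
Lemma superblock_gain (t : R) s : 0 <= t < 1 -> exists p q : nat,
  [/\ (s <= p)%N, (p <= q)%N &
   1 <= complex.Im (\sum_(p <= n < q) (lv n)%:C * kn n (X n) (zT t))].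
Proof.
move=> t01; pose i0 := Num.truncn (t * (Js s)%:R).
have mJ : (m s <= Js s)%N by rewrite leq_pmull.
(* The stretch stops just before the block [d = 0], whose centre may be arbitrarily close to the
   point. *)
pose A := (ss s + (Js s + i0 - m s))%N; pose B := (A + m s)%N.
exists (st A), (st B); split.
- apply: leq_trans (leq_id_start (blen_gt0 Lb_gt0) A).
  by apply: (leq_trans (leq_id_start slen_gt0 s)); rewrite leq_addr.
- by apply: leq_start; rewrite leq_addr.
rewrite sum_start ?leq_addr // Im_sum.
have -> : \sum_(A <= b < B) complex.Im (\sum_(st b <= n < st b.+1) (lv n)%:C * kn n (X n) (zT t))
  = \sum_(i < m s) complex.Im (\sum_(st (ss s + (Js s + i0 - i.+1)) <= n <
      st (ss s + (Js s + i0 - i.+1)).+1) (lv n)%:C * kn n (X n) (zT t)).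
  rewrite /B -{1}[A]add0n [(A + _)%N]addnC big_addn addnK big_mkord.
  rewrite (reindex_inj rev_ord_inj); apply: eq_bigr => i _ /=.
  have -> : (m s - i.+1 + A = ss s + (Js s + i0 - i.+1))%N.
    by have := ltn_ord i; rewrite /A; lia.
  by [].
have Jr : 0 < (Js s)%:R :> R by rewrite ltr0n Js_gt0.
have Lr : 0 < (Ls s)%:R :> R by rewrite ltr0n Ls_gt0.
have e0 := eps_gt0 s; have l0 := Lam_gt0 s; have K1 := K_ge1 s.
pose lb := 64 / ((Js s)%:R * eps s * Lam (m s)).
have lb0 : 0 < lb by rewrite divr_gt0 // !mulr_gt0.
apply: (@le_trans _ _ (\sum_(i < m s) lb * ((eps s * (Js s)%:R / 32) * i.+2%:R^-1
    - 11 * (Js s)%:R / (K s)%:R * (i.+1%:R ^+ 2)^-1))); last first.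
  apply: ler_sum => i _; have im := ltn_ord i.
  have hd : (0 < i.+1 <= m s)%N by [].
  have := zT_slot t01 hd; rewrite -/i0 => -[c /andP[cl cu]].
  set b := (ss s + _)%N => -[ez es].
  have d0 : 0 < i.+1%:R :> R by rewrite ltr0n.
  have dd0 : 0 < i.+2%:R :> R by rewrite ltr0n.
  have dJ0 : 0 < i.+1%:R / (Js s)%:R :> R by rewrite divr_gt0.
  have c4 : c <= 1 / 4.
    apply: (le_trans cu); rewrite ler_pdivrMr //.
    have : i.+2%:R <= 2 * (m s)%:R :> R.
      by rewrite -natrM ler_nat mul2n -addnn -addn1 leq_add.
    by rewrite /Js natrM; lra.
  have cp : 0 < c by apply: lt_le_trans cl.
  have r1 : c <= normc (1 - zT c) by apply: normc_1BzT_ge; apply/andP; split; lra.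
  have r2 : normc (1 - zT c) <= 8 * c by apply: normc_1BzT_le; apply/andP; split; lra.
  have r0 : 0 < normc (1 - zT c) by apply: lt_le_trans r1.
  have hIm : 1 / 2 / normc (1 - zT c) <= complex.Im (1 - zT c)^-1.
    by apply: Im_inv_1BzT; rewrite cp.
  have emb : mbb b * (Lb b)%:R = eps s by rewrite /mbb /Lb es divfK ?gt_eqF.
  have elb : lbb b = lb by rewrite /lbb es.
  have hm : mbb b * (Lb b)%:R <= 1 / 32 by rewrite emb; have := eps_le s; lra.
  have := @block_gain R Lb tbb mbb Vb Lb_gt0 mbb_ge0 Vb_ge0 Vb_cover sum_V' sum_mbb2
    lbb b t (lbb_ge0 b) hm.
  rewrite ez => /(_ r0 hIm); apply: le_trans.
  rewrite emb elb -[lb / _ * _]mulrA ler_wpM2l ?(ltW lb0) //.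
  have -> : Lb b = Ls s by rewrite /Lb es.
  move: r1 r2 r0; set r := normc _ => r1 r2 r0.
  have i1 : r^-1 <= (Js s)%:R / i.+1%:R.
    rewrite -[_ / _]invf_div lef_pV2 ?posrE //.
    exact: le_trans r1.
  have i2 : (Js s)%:R / (8 * i.+2%:R) <= r^-1.
    rewrite -[_ / _]invf_div lef_pV2 ?posrE //; last by rewrite divr_gt0 // mulr_gt0.
    apply: (le_trans r2); rewrite -mulrA ler_wpM2l //.
  have ri0 : 0 < r^-1 by rewrite invr_gt0.
  have i3 : r^-1 * r^-1 <= (Js s)%:R / i.+1%:R * ((Js s)%:R / i.+1%:R).
    by apply: ler_pM => //; exact: ltW.
  have -> : r^-1 * (eps s / 4 - 11 / (Ls s)%:R / r) =
     eps s / 4 * r^-1 - 11 / (Ls s)%:R * (r^-1 * r^-1) by ring.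
  apply: lerB.
    apply: (@le_trans _ _ (eps s / 4 * ((Js s)%:R / (8 * i.+2%:R)))).
      by rewrite le_eqVlt; apply/orP; left; apply/eqP; field; rewrite gt_eqF.
    by rewrite ler_wpM2l // divr_ge0 // ltW.
  apply: (@le_trans _ _ (11 / (Ls s)%:R * ((Js s)%:R / i.+1%:R * ((Js s)%:R / i.+1%:R)))).
    by rewrite ler_wpM2l // divr_ge0 // ltW.
  rewrite le_eqVlt; apply/orP; left; apply/eqP; rewrite LsE.
  by field; rewrite !gt_eqF ?Kr_gt0.
rewrite -mulr_sumr sumrB -!mulr_sumr -/(Lam (m s)).
have S2 := sum_invsqr R (m s).
(* Makes half of the main term, [eps * J * Lam / 64], at least [32 J], above the total error
   [22 J]. *)
have eL : 32 * 64 <= eps s * Lam (m s).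
  have e20 : 0 < eps s ^+ 2 by rewrite exprn_gt0.
  have : c1 * 2 ^+ s <= Lam (m s) * eps s ^+ 2 by rewrite -ler_pdivrMr // Lam_ge.
  have h1 : c1 * 1 <= c1 * 2 ^+ s by rewrite ler_wpM2l ?pow2_ge1 // ltW ?c1_gt0.
  move=> /(le_trans h1); rewrite mulr1 c1E c0E expr2 mulrA [Lam _ * _]mulrC.
  have el0 : 0 <= eps s * Lam (m s) by rewrite mulr_ge0 // ltW.
  have := ler_wpM2l el0 (eps_le s); lra.
set S := \sum_(i < m s) (i.+1%:R ^+ 2)^-1 in S2 *.
have h1 : 11 * (Js s)%:R / (K s)%:R * S <= 11 * (Js s)%:R * 2.
  have S0 : 0 <= S by apply: sumr_ge0 => i _; rewrite invr_ge0 exprn_ge0.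
  have J11 : 0 <= 11 * (Js s)%:R :> R by rewrite mulr_ge0.
  have a0 : 0 <= 11 * (Js s)%:R / (K s)%:R :> R by rewrite divr_ge0.
  have a1 : 11 * (Js s)%:R / (K s)%:R <= 11 * (Js s)%:R :> R.
    by rewrite ler_piMr // invf_le1 ?Kr_gt0.
  exact: (ler_pM a0 S0 a1 S2).
apply: (@le_trans _ _ (lb * (eps s * (Js s)%:R / 64 * Lam (m s)))).
  by rewrite le_eqVlt; apply/orP; left; apply/eqP; rewrite /lb; field; rewrite !gt_eqF.
rewrite ler_wpM2l ?(ltW lb0) //.
have : 32 * 64 * (Js s)%:R <= eps s * Lam (m s) * (Js s)%:R by rewrite ler_wpM2r // ltW.
have -> : eps s * (Js s)%:R / 64 * Lam (m s) = eps s * Lam (m s) * (Js s)%:R / 64 by ring.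
have -> : eps s * (Js s)%:R / 32 * Lam (m s) = eps s * Lam (m s) * (Js s)%:R / 32 by ring.
move: (eps s * Lam (m s) * _) h1 => x h1.
set y := _ / (K s)%:R * _ in h1 *; lra.
Qed.

Lemma divergent_expansion :
  exists (sigma : {measure set (measurableTypeR R) -> \bar R})
         (phi : nat -> {poly R[i]}) (alpha : nat -> R[i]),
    circle_prob sigma /\ infinite_support sigma /\ szego_class sigma /\
    orthonormal_polys sigma phi /\ ell2 alpha /\
    (forall t : R, (0 <= t < 1)%R ->
       ~ cvgC (fun n => \sum_(k < n) alpha k * (phi k).[zT t])).
Proof.
have gd := @all_good R Lb tbb mbb Vb Lb_gt0 mbb_ge0 Vb_ge0 Vb_cover sum_V' sum_mbb2.
have hk := @ksq_bounds R Lb tbb mbb Vb Lb_gt0 mbb_ge0 Vb_ge0 Vb_cover sum_V' sum_mbb2.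
have hQ n t : normc ((Phis X mv n).[zT t] - 1) <= 1 / 16 by have [] := gd n.
have hv n : normc (verb X mv n) < 1.
  exact: (good_verb_lt1 Lb_gt0 mbb_ge0 sum_mbb2 (gd n)).
have hcQ t := @Phis_cvg R Lb tbb mbb Vb Lb_gt0 mbb_ge0 Vb_ge0 Vb_cover sum_V' sum_mbb2
  t (tail_V_small t).
have [sigma [h1 h2 h3 h4]] := opuc_exists hQ hk hv hcQ.
(* The square root completes that of [ophi], so that [alpha n * phi_n] is the weight [lv n] times
   the kernel. *)
pose alpha n : R[i] := (lv n * Num.sqrt (ksq X mv n))%:C * conjc (Phi X mv n).[X n].
exists sigma, (ophi X mv), alpha; do 4 split=> //; split.
- have sq n : sqmod (alpha n) <= 2 * lv n ^+ 2.
    rewrite /sqmod -sqr_normcE /alpha normcM normc_conj normc_real exprMn.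
    rewrite real_normK ?num_real // exprMn sqr_sqrtr; last first.
      by have /andP[a _] := hk n; lra.
    rewrite /bpoint normc_Phi_zT -mulrA mulrC ler_wpM2r ?sqr_ge0 //.
    rewrite expr2; have := good_mul3 Lb_gt0 sum_mbb2 (tbb (locate (blen Lb) n).1)
      (tbb (locate (blen Lb) n).1) (gd n); lra.
  apply: nondecreasing_is_cvgn.
    apply/nondecreasing_seqP => n; rewrite !seriesEnat /= big_nat_recr //= lerDl.
    by rewrite addr_ge0 ?sqr_ge0.
  exists 4 => _ [n _ <-]; rewrite seriesEnat /=.
  apply: (@le_trans _ _ (\sum_(0 <= k < n) 2 * lv k ^+ 2)).
    by apply: ler_sum => k _; exact: sq.
  rewrite -mulr_sumr; have := sum_blam2 Lb_gt0 lbb n; have := sum_lbb2 n.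
  by set a := \sum_(_ <= _ < _) _; set b := \sum_(_ <= _ < _) _; lra.
move=> t t01 [_ cIm].
have term n : alpha n * (ophi X mv n).[zT t] = (lv n)%:C * kern X mv n (X n) (zT t).
  have k0 : 0 <= ksq X mv n by have /andP[a _] := hk n; lra.
  have ek : (ksq X mv n)%:C = (Num.sqrt (ksq X mv n))%:C * (Num.sqrt (ksq X mv n))%:C.
    by rewrite -real_complexM -expr2 sqr_sqrtr.
  by rewrite /alpha /ophi hornerZ /kern ek real_complexM; ring.
(* Convergence would make all late differences of partial sums smaller than 1, against
   [superblock_gain]; starting at [N + M] passes both thresholds of the Cauchy condition. *)
have /cauchy_cvgP/cauchy_ballP/(_ 1 ltr01) := cIm.
move=> [[A B] /= [[N _ hN] [M _ hM]]] hAB.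
have [p [q [hp hpq hg]]] := superblock_gain (N + M) t01.
have Ap : A (complex.Im (\sum_(k < p) alpha k * (ophi X mv k).[zT t])).
  by apply: (hN p); rewrite /=; apply: leq_trans hp; rewrite leq_addr.
have Bq : B (complex.Im (\sum_(k < q) alpha k * (ophi X mv k).[zT t])).
  by apply: (hM q); rewrite /=; apply: leq_trans hpq; apply: leq_trans hp; rewrite leq_addl.
have := hAB (_, _) (conj Ap Bq); rewrite /ball /= => hlt.
have e : \sum_(k < q) alpha k * (ophi X mv k).[zT t] =
  \sum_(k < p) alpha k * (ophi X mv k).[zT t] +
  \sum_(p <= n < q) (lv n)%:C * kern X mv n (X n) (zT t).
  rewrite -!(big_mkord xpredT (fun k => alpha k * (ophi X mv k).[zT t])).
  rewrite (big_cat_nat (n := p)) //=; congr (_ + _).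
  by apply: eq_bigr => n _; exact: term.
move: hlt; rewrite e Im_add opprD addrA subrr sub0r normrN.
by rewrite ltNge (le_trans hg (ler_norm _)).
Qed.

End Construction.

Theorem theorem1p3 (R : realType) :
  exists (sigma : {measure set (measurableTypeR R) -> \bar R})
         (phi : nat -> {poly R[i]}) (alpha : nat -> R[i]),
    circle_prob sigma /\ infinite_support sigma /\ szego_class sigma /\
    orthonormal_polys sigma phi /\ ell2 alpha /\
    (forall t : R, (0 <= t < 1)%R ->
       ~ cvgC (fun n => \sum_(k < n) alpha k * (phi k).[zT t])).
Proof.
have [p hp] := choice (superblock_size (erefl (64 * 64 : R)) (erefl (16 * (64 * 64) : R))).
apply: (@divergent_expansion R _ _ (erefl (64 * 64 : R)) (erefl (16 * (64 * 64) : R))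
  (fun s => (p s).1) (fun s => (p s).2)) => s; by have [] := hp s.
Qed.
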